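(* Let $\gamma_1,\gamma_2$ be constants, each real or purely imaginary, let $f\in(0,\pi/2)$, $k_1=\cos f$, $k_2=\sin f$. On $T^*\mathbb{R}^2$ with canonical coordinates $(q_1,q_2,p_1,p_2)$ let $$H_{(2)}=p_1^2+p_2^2+\gamma_1(q_1p_1+q_2p_2)+\gamma_2(q_1p_1+q_2p_2)^2 ,$$ let $K_e$ be the elliptic Haantjes operator defined in the context, and put $$T=\gamma_2(q_1^2+k_1^2q_2^2)+k_2^2,\qquad P=\gamma_2k_1^2k_2^2q_2^2,\qquad S=\sqrt{T^2-4P}.$$ 1. $T^2-4P\ge0$ throughout $\mathbb{R}^2$ for any sign of $\gamma_2$. For $\gamma_2>0$, $$T^2-4P=\bigl[\gamma_2q_1^2+(\sqrt{\gamma_2}\,k_1q_2+k_2)^2\bigr]\bigl[\gamma_2q_1^2+(\sqrt{\gamma_2}\,k_1q_2-k_2)^2\bigr],$$ which vanishes only at the two points $(q_1,q_2)=(0,\pm k_2/(\sqrt{\gamma_2}\,k_1))$. 2. The Nijenhuis operator $\mathcal N_e=K_e-\tfrac12\operatorname{tr}(K_e)\,I$ has eigenvalues $\tilde\lambda_{1,2}=\tfrac12(T\pm S)$, and these are Darboux--Haantjes position coordinates for $K_e$: $$Q_{1,2}=\tilde\lambda_{1,2}(q_1,q_2)=\tfrac12(T\pm S),\qquad\tilde\lambda_1>\tilde\lambda_2 .$$ The canonical transformation is the extended point transformation with generating function $F_2(q,P)=P_1Q_1(q)+P_2Q_2(q)$, so $\mathbf p=J^T\mathbf P$ with $J_{ij}=\partial\tilde\lambda_i/\partial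 q_j$ and $\mathbf P=(J^{-1})^T\mathbf p$. The Jacobian $J$ is invertible wherever $\tilde\lambda_1\ne\tilde\lambda_2$, i.e. wherever $S\neq0$; hence the coordinates are well-defined on all of $\mathbb{R}^2$ minus the focal locus $\{S=0\}$. 3. In the coordinates $(\tilde\lambda_1,\tilde\lambda_2,P_1,P_2)$ with $\tilde\lambda_1>k_2^2>\tilde\lambda_2>0$, the Hamiltonian takes the Stäckel form $$H_{(2)}=\frac{h(\tilde\lambda_1)P_1^2-h(\tilde\lambda_2)P_2^2+g(\tilde\lambda_1)P_1-g(\tilde\lambda_2)P_2}{\tilde\lambda_1-\tilde\lambda_2},$$ where $h(\lambda)=4\gamma_2\,\lambda(\lambda-k_2^2)(\lambda+k_1^2)$ and $g(\lambda)=2\gamma_1\,\lambda(\lambda-k_2^2)$. The denominator $\tilde\lambda_1-\tilde\lambda_2=S$ is nonzero on the open set where the coordinate map is defined.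
   Context: With $\mathcal J=q_1p_2-q_2p_1$, the operator $K_e$ is the $(1,1)$ tensor field $K_e=-\gamma_2k_1^2\,K_{\mathcal J^2}-k_2^2\,K_{I_2}$, where, with respect to the frame $\partial_{q_1},\partial_{q_2},\partial_{p_1},\partial_{p_2}$, $$K_{\mathcal J^2}=\begin{pmatrix}q_2^2&-q_1q_2&0&0\\-q_1q_2&q_1^2&0&0\\0&-\mathcal J&q_2^2&-q_1q_2\\\mathcal J&0&-q_1q_2&q_1^2\end{pmatrix},\qquad K_{I_2}=\begin{pmatrix}0&0&0&0\\-\gamma_2q_1q_2&1+\gamma_2q_1^2&0&0\\0&-\gamma_2q_1p_2&0&-\gamma_2q_1q_2\\\gamma_2q_1p_2&0&0&1+\gamma_2q_1^2\end{pmatrix}.$$ It satisfies $K_e^T\,dH_{(2)}=dI_e$ with $I_e=-\gamma_2k_1^2\mathcal J^2-k_2^2I_2$ and $I_2=(1+\gamma_2(q_1^2+q_2^2))p_2^2+\gamma_1q_2p_2$. A $(1,1)$ tensor field $L$ is a Nijenhuis operator if $L^2[X,Y]+[LX,LY]-L([X,LY]+[LX,Y])=0$ for all vector fields $X,Y$. Darboux--Haantjes coordinates: coordinates $(Q,P)$ in which $\omega=dq_1\wedge dp_1+dq_2\wedge dp_2$ equals $\sum_idQ_i\wedge dP_i$ and the operator is diagonal. Extended point transformation: a canonical transformation whose new positions depend only on the old positions. $\mathbf p=(p_1,p_2)^T$, $\mathbf P=(P_1,P_2)^T$; the scalar function $P$ in the definition of $S$ is unrelated to the momenta $P_1,P_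2$.
   Formalization: J is singular where q1q2=0 or γ2=0 even if S≠0; the theorem has J invertible iff also γ2q1q2≠0, with coordinates near each such point. For imaginary γ2 the branch cut T²−4P<0 of S is also removed; T²−4P≥0 and λ1>λ2 are stated for real γ2. *)

(* Defs.v *)
From HB Require Import structures.
From mathcomp Require Import all_boot all_order all_algebra.
From mathcomp Require Import all_classical all_reals all_analysis.
From mathcomp Require Import complex.
Set Implicit Arguments.
Unset Strict Implicit.
Unset Printing Implicit Defensive.
Import Order.TTheory GRing.Theory Num.Theory.
Import numFieldNormedType.Exports.
Local Open Scope classical_set_scope.
Local Open Scope complex_scope.
Local Open Scope ring_scope.

(* Scalars are complex, because the constants gamma_1, gamma_2 may be purely
   imaginary; positions and old momenta are real.  On R[i] the order of the
   library is partial: x <= y (x < y) means that y - x is a nonnegative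
   (positive) real number. *)

Fixpoint Ck_on (R : realType) (n k : nat) (U : set 'rV[R]_n)
    (F : 'rV[R]_n -> R) : Prop :=
  if k is k'.+1 then
    (forall x, U x -> differentiable F x) /\
    (forall j : 'I_n, Ck_on k' U (fun x => 'D_(delta_mx 0 j) F x))
  else forall x, U x -> {for x, continuous F}.

(* C^infinity, for a complex-valued F; meant for an open set U *)
Definition smooth_on (R : realType) (n : nat) (U : set 'rV[R]_n)
    (F : 'rV[R]_n -> R[i]) : Prop :=
  forall k, Ck_on k U (fun x => complex.Re (F x)) /\
            Ck_on k U (fun x => complex.Im (F x)).

Definition partial (R : realType) (n : nat) (j : 'I_n)
    (F : 'rV[R]_n -> R[i]) (x : 'rV[R]_n) : R[i] :=
  'D_(delta_mx 0 j) (fun y => complex.Re (F y)) x +i*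
  'D_(delta_mx 0 j) (fun y => complex.Im (F y)) x.

Definition jac (R : realType) (m n : nat) (F : 'rV[R]_n -> 'cV[R[i]]_m)
    (x : 'rV[R]_n) : 'M[R[i]]_(m, n) :=
  \matrix_(i, j) partial j (fun y => F y i 0) x.

(* A phase space point is x = (q1, q2, p1, p2). *)
Definition pos (R : realType) (x : 'rV[R]_(2 + 2)) : 'rV[R]_2 := lsubmx x.
Definition mom (R : realType) (x : 'rV[R]_(2 + 2)) : 'rV[R]_2 := rsubmx x.

Definition crd (R : realType) (v : 'rV[R]_2) (j : 'I_2) : R[i] := (v 0 j)%:C.

Definition colC (R : realType) (v : 'rV[R]_2) : 'cV[R[i]]_2 :=
  \col_j crd v j.

(* Vector fields are columns of components in the frame d/dq1, d/dq2, d/dp1,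
   d/dp2, and a (1,1) tensor field acts on them by left multiplication. *)
Definition vfield (R : realType) := 'rV[R]_(2 + 2) -> 'cV[R[i]]_(2 + 2).
Definition tensor11 (R : realType) := 'rV[R]_(2 + 2) -> 'M[R[i]]_(2 + 2).

Definition smooth_vfield (R : realType) (X : vfield R) : Prop :=
  forall i, smooth_on setT (fun x => X x i 0).

Definition lie (R : realType) (X Y : vfield R) : vfield R :=
  fun x => jac Y x *m X x - jac X x *m Y x.

Definition app (R : realType) (L : tensor11 R) (X : vfield R) : vfield R :=
  fun x => L x *m X x.

Definition Nijenhuis_operator (R : realType) (L : tensor11 R) : Prop :=
  (forall i j, smooth_on setT (fun x => L x i j)) /\
  (forall X Y : vfield R, smooth_vfield X -> smooth_vfield Y ->
   forall x, app L (app L (lie X Y)) x + lie (app L X) (app L Y) x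
             - app L (fun y => lie X (app L Y) y + lie (app L X) Y y) x = 0).

(* Gram matrix of omega = dq1 /\ dp1 + dq2 /\ dp2, so omega(X, Y) is
   X^T *m Omega *m Y. *)
Definition Omega (R : realType) : 'M[R[i]]_(2 + 2) :=
  block_mx 0 1%:M (- 1%:M) 0.

(* The coordinates may be complex (they are real when gamma_2 is real), so
   they form an injective smooth map with invertible differential. *)
Definition coordinates_on (R : realType) (W : set 'rV[R]_(2 + 2))
    (Phi : vfield R) : Prop :=
  [/\ open W,
      forall i, smooth_on W (fun x => Phi x i 0),
      {in W &, injective Phi} &
      forall x, W x -> jac Phi x \in unitmx].

Definition canonical_on (R : realType) (W : set 'rV[R]_(2 + 2))
    (Phi : vfield R) : Prop :=
  forall x, W x -> (jac Phi x)^T *m Omega R *m jac Phi x = Omega R.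

Definition extended_point_transformation (R : realType)
    (W : set 'rV[R]_(2 + 2)) (Phi : vfield R) : Prop :=
  canonical_on W Phi /\
  forall x y, W x -> W y -> pos x = pos y ->
    usubmx (Phi x) = usubmx (Phi y).

Definition Darboux_Haantjes (R : realType) (W : set 'rV[R]_(2 + 2))
    (L : tensor11 R) (Phi : vfield R) : Prop :=
  [/\ coordinates_on W Phi, canonical_on W Phi &
      forall x, W x -> is_diag_mx (jac Phi x *m L x *m invmx (jac Phi x))].

(* The canonical transformation (q,p) <-> (Q,P) generated by F2(q,P):
   p = dF2/dq, Q = dF2/dP.  The second derivative is the complex one. *)
Definition generated_by (R : realType)
    (F2 : 'rV[R]_2 -> 'cV[R[i]]_2 -> R[i])
    (q p : 'rV[R]_2) (Q P : 'cV[R[i]]_2) : Prop :=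
  (forall j, crd p j = partial j (fun y => F2 y P) q) /\
  (forall i, Q i 0 = 'D_(delta_mx i 0) (F2 q : _ -> R[i]^o) P).

Definition H2 (R : realType) (g1 g2 : R[i]) (x : 'rV[R]_(2 + 2)) : R[i] :=
  let q := crd (pos x) in let p := crd (mom x) in
  p 0 ^+ 2 + p 1 ^+ 2 + g1 * (q 0 * p 0 + q 1 * p 1)
  + g2 * (q 0 * p 0 + q 1 * p 1) ^+ 2.

Definition mx4 (R : realType) (rows : seq (seq R[i])) : 'M[R[i]]_(2 + 2) :=
  \matrix_(i, j) nth 0 (nth [::] rows i) j.

Definition K_J2 (R : realType) : tensor11 R := fun x =>
  let q1 := crd (pos x) 0 in let q2 := crd (pos x) 1 in
  let p1 := crd (mom x) 0 in let p2 := crd (mom x) 1 in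
  let J := q1 * p2 - q2 * p1 in
  mx4 [:: [:: q2 ^+ 2;   - (q1 * q2); 0;           0];
          [:: - (q1 * q2); q1 ^+ 2;   0;           0];
          [:: 0;           - J;       q2 ^+ 2;     - (q1 * q2)];
          [:: J;           0;         - (q1 * q2); q1 ^+ 2]].

Definition K_I2 (R : realType) (g2 : R[i]) : tensor11 R := fun x =>
  let q1 := crd (pos x) 0 in let q2 := crd (pos x) 1 in
  let p1 := crd (mom x) 0 in let p2 := crd (mom x) 1 in
  mx4 [:: [:: 0;                0;                  0; 0];
          [:: - (g2 * q1 * q2); 1 + g2 * q1 ^+ 2;   0; 0];
          [:: 0;                - (g2 * q1 * p2);   0; - (g2 * q1 * q2)];
          [:: g2 * q1 * p2;     0;                  0; 1 + g2 * q1 ^+ 2]].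

Definition K_e (R : realType) (g2 k1 k2 : R[i]) : tensor11 R := fun x =>
  - (g2 * k1 ^+ 2) *: K_J2 x - k2 ^+ 2 *: K_I2 g2 x.

Definition N_e (R : realType) (g2 k1 k2 : R[i]) : tensor11 R := fun x =>
  K_e g2 k1 k2 x - (2^-1 * \tr (K_e g2 k1 k2 x))%:M.

Definition ellT (R : realType) (g2 k1 k2 : R[i]) (q : 'rV[R]_2) : R[i] :=
  g2 * (crd q 0 ^+ 2 + k1 ^+ 2 * crd q 1 ^+ 2) + k2 ^+ 2.

Definition ellP (R : realType) (g2 k1 k2 : R[i]) (q : 'rV[R]_2) : R[i] :=
  g2 * k1 ^+ 2 * k2 ^+ 2 * crd q 1 ^+ 2.

Definition discr (R : realType) (g2 k1 k2 : R[i]) (q : 'rV[R]_2) : R[i] :=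
  ellT g2 k1 k2 q ^+ 2 - 4 * ellP g2 k1 k2 q.

(* sqrtc is the principal square root: nonnegative on nonnegative reals,
   discontinuous only along the negative reals. *)
Definition ellS (R : realType) (g2 k1 k2 : R[i]) (q : 'rV[R]_2) : R[i] :=
  sqrtc (discr g2 k1 k2 q).

Definition lam1 (R : realType) (g2 k1 k2 : R[i]) (q : 'rV[R]_2) : R[i] :=
  2^-1 * (ellT g2 k1 k2 q + ellS g2 k1 k2 q).

Definition lam2 (R : realType) (g2 k1 k2 : R[i]) (q : 'rV[R]_2) : R[i] :=
  2^-1 * (ellT g2 k1 k2 q - ellS g2 k1 k2 q).

Definition lam (R : realType) (g2 k1 k2 : R[i]) (q : 'rV[R]_2) :
    'cV[R[i]]_2 :=
  \col_i (if i == 0 then lam1 g2 k1 k2 q else lam2 g2 k1 k2 q).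

(* The complement of the focal locus S = 0.  The clause on the branch cut of
   the square root matters only for imaginary gamma_2: for real gamma_2 the
   discriminant is nonnegative everywhere. *)
Definition off_focal (R : realType) (g2 k1 k2 : R[i]) : set 'rV[R]_2 :=
  [set q | ellS g2 k1 k2 q != 0 /\ ~~ (discr g2 k1 k2 q < 0)].

(* lam is even in q1 and in q2, and
   \det Jmx = 4 g2^2 k1^2 k2^2 q1 q2 / S where S != 0, so that Jmx is singular
   on both coordinate axes, and everywhere if g2 = 0. *)
Definition Jmx (R : realType) (g2 k1 k2 : R[i]) (q : 'rV[R]_2) :
    'M[R[i]]_2 := jac (lam g2 k1 k2) q.

Definition newP (R : realType) (g2 k1 k2 : R[i]) (q p : 'rV[R]_2) :
    'cV[R[i]]_2 :=
  (invmx (Jmx g2 k1 k2 q))^T *m colC p.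

Definition ell_map (R : realType) (g2 k1 k2 : R[i]) : vfield R := fun x =>
  col_mx (lam g2 k1 k2 (pos x)) (newP g2 k1 k2 (pos x) (mom x)).

Definition F2gen (R : realType) (g2 k1 k2 : R[i]) (q : 'rV[R]_2)
    (P : 'cV[R[i]]_2) : R[i] :=
  P 0 0 * lam1 g2 k1 k2 q + P 1 0 * lam2 g2 k1 k2 q.

Definition hfun (R : realType) (g2 k1 k2 l : R[i]) : R[i] :=
  4 * g2 * l * (l - k2 ^+ 2) * (l + k1 ^+ 2).

Definition gfun (R : realType) (g1 k2 l : R[i]) : R[i] :=
  2 * g1 * l * (l - k2 ^+ 2).

(* Main.v *)
(* On the base, N_e restricts to a 2x2 tensor A(q) with trace T and determinant
   P, and N_e is the complete cotangent lift of A.  Its eigenvalues are the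
   roots of l^2 - T l + P, so each of them is smooth off the branch locus of
   S = sqrt(T^2 - 4 P), and differentiating the equation gives
   (2 l - T) dl = l dT - dP with 2 l - T = +S or -S.  From this formula follow
   the Jacobian determinant, the symmetry of the Hessians, the identity
   dl A = l dl, and the Staeckel form after eliminating q through T and P.
   With P now the new momenta, differentiating J^T P = p makes the differential of
   (q, p) -> (lambda, P) block triangular, with blocks J, B, J^-T, where
   J^T B = - sum_i P_i Hess(lambda_i).  Symmetry of the Hessians gives
   canonicity, and the derivative of J A = diag(lambda) J, contracted with P and
   antisymmetrized, matches the lower left block of N_e, so that N_e becomes
   diagonal. *)
Require Import Defs.
From HB Require Import structures.
From mathcomp Require Import all_boot all_order all_algebra.
From mathcomp Require Import all_classical all_reals all_analysis.
From mathcomp Require Import complex.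
From mathcomp Require Import ring.
Import Order.TTheory GRing.Theory Num.Theory.
Import numFieldNormedType.Exports.
Local Open Scope classical_set_scope.
Local Open Scope complex_scope.
Local Open Scope ring_scope.

(** The principal root enters only through two facts: its square is the discriminant, and it is
    smooth off the nonpositive reals. Derivatives then come from polynomial relations that keep the
    factor [lamR], which is S or - S, until it is cancelled at the end; so most computations close
    with a ring identity. For nonzero gamma_2 the eigenvalues determine T and P, hence the squares
    of q1 and q2 but not their signs. Injectivity therefore fails on the full complement of the
    focal locus. Around a point where J is invertible the chart is the open quadrant of that point,
    with the focal locus and the branch cut removed; such a point lies on neither axis, so this set
    is a neighbourhood of it. The vanishing of the torsion is a separate matter: the torsion is
    tensorial and [N_e] has polynomial entries, which leaves a finite check. *)

Lemma near_eq_differentiable (R : numFieldType) (V W : normedModType R)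
    (F G : V -> W) (x : V) :
  {near x, F =1 G} -> differentiable F x -> differentiable G x.
Proof.
move=> FG dF.
have GFx : G x = F x by rewrite (nbhs_singleton FG).
(* [G] has at [x] the first-order expansion of [F], with the differential of [F]; uniqueness of the
   differential then identifies ['d G x] with ['d F x]. *)
have eG : G \o shift x = cst (G x) + 'd F x +o_ 0 id.
  have /diff_locally /eqaddoP eF := dF.
  apply/eqaddoP => _/posnumP[e].
  have FG0 : \forall y \near (0 : V), F (y + x) = G (y + x).
    have : \forall y \near x, F y = G y by [].
    by rewrite (near_shift 0) subr0.
  apply: filterS2 FG0 (eF _ [gt0 of e%:num]) => y FGy.
  by rewrite /= !fctE /= -FGy GFx.
apply/diff_locallyP.
have -> : 'd G x = 'd F x :> (V -> W).
  by apply: diff_unique => //; exact: diff_continuous.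
by split=> //; exact: diff_continuous.
Qed.

Lemma near_eq_continuous (T U : topologicalType) (f g : T -> U) (x : T) :
  {near x, f =1 g} -> {for x, continuous f} -> {for x, continuous g}.
Proof.
move=> fg cf; have cfx : f @ x --> f x by exact: cf.
suff : g @ x --> g x by [].
by rewrite -(nbhs_singleton fg); apply: cvg_trans cfx; exact: near_eq_cvg.
Qed.

(** * Real functions of class C^k *)

Section Ck.
Context (R : realType) (n : nat).
Implicit Types (U : set 'rV[R]_n) (F G : 'rV[R]_n -> R) (x v : 'rV[R]_n).

(** [Ck_on] speaks of the derivative as a function on the whole space, while the rules of
    differentiation give it only at points of [U]. This lemma exchanges that function for a formula
    valid on [U]; openness lets the agreement pass to derivatives. *)
Lemma Ck_on_ext k U F G : open U -> (forall x, U x -> F x = G x) ->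
  Ck_on k U F -> Ck_on k U G.
Proof.
move=> oU; elim: k F G => [|k IH] F G FG /=.
  move=> cF x Ux; apply: near_eq_continuous (cF x Ux).
  by apply: filterS (open_nbhs_nbhs (conj oU Ux)) => y /FG.
have nFG x : U x -> {near x, F =1 G}.
  by move=> Ux; apply: filterS (open_nbhs_nbhs (conj oU Ux)) => y /FG.
move=> [dF CF]; split=> [x Ux|j].
  by apply: near_eq_differentiable (dF x Ux); exact: nFG.
apply: IH (CF j) => x Ux; apply: near_eq_derive; exact: nFG.
Qed.

Lemma Ck_onS k U F : Ck_on k.+1 U F -> Ck_on k U F.
Proof.
elim: k F => [|k IH] F /= [dF CF].
  by move=> x Ux; exact/differentiable_continuous/dF.
by split=> // j; apply: IH; exact: CF.
Qed.

Lemma Ck_on_sub k U U' F : U' `<=` U -> Ck_on k U F -> Ck_on k U' F.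
Proof.
move=> sU; elim: k F => [|k IH] F /=; first by move=> cF x /sU; exact: cF.
by move=> [dF CF]; split=> [x /sU|j]; [exact: dF|exact/IH/CF].
Qed.

Lemma Ck_on_cst k U (a : R) : Ck_on k U (fun=> a).
Proof.
elim: k a => [|k IH] a /=; first by move=> x _; exact: cst_continuous.
split=> [x _|j]; first exact: differentiable_cst.
rewrite (_ : 'D_ _ _ = fun=> 0); first exact: IH.
by apply/funext => x; rewrite derive_cst.
Qed.

Lemma Ck_onD k U F G : open U ->
  Ck_on k U F -> Ck_on k U G -> Ck_on k U (fun x => F x + G x).
Proof.
move=> oU; elim: k F G => [|k IH] F G /=.
  by move=> cF cG x Ux; apply: continuousD; [exact: cF|exact: cG].
move=> [dF CF] [dG CG]; split=> [x Ux|j].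
  by apply: differentiableD; [exact: dF|exact: dG].
apply: (Ck_on_ext _ _ (fun x => 'D_(delta_mx 0 j) F x + 'D_(delta_mx 0 j) G x))
  => //; last exact: IH.
by move=> x Ux; rewrite deriveD //; apply: diff_derivable; [exact: dF|exact: dG].
Qed.

Lemma Ck_onN k U F : open U -> Ck_on k U F -> Ck_on k U (fun x => - F x).
Proof.
move=> oU; elim: k F => [|k IH] F /=.
  by move=> cF x Ux; apply: continuousN; exact: cF.
move=> [dF CF]; split=> [x Ux|j]; first by apply: differentiableN; exact: dF.
apply: (Ck_on_ext _ _ (fun x => - 'D_(delta_mx 0 j) F x)) => //; last exact: IH.
by move=> x Ux; rewrite deriveN //; apply: diff_derivable; exact: dF.
Qed.

Lemma Ck_onM k U F G : open U ->
  Ck_on k U F -> Ck_on k U G -> Ck_on k U (fun x => F x * G x).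
Proof.
move=> oU; elim: k F G => [|k IH] F G.
  by move=> cF cG x Ux; apply: continuousM; [exact: cF|exact: cG].
move=> CF1 CG1; have [CF0 CG0] := (Ck_onS _ _ _ CF1, Ck_onS _ _ _ CG1).
move: CF1 CG1 => /= [dF CF] [dG CG]; split=> [x Ux|j].
  by apply: differentiableM; [exact: dF|exact: dG].
apply: (Ck_on_ext _ _ (fun x => F x * 'D_(delta_mx 0 j) G x +
                             G x * 'D_(delta_mx 0 j) F x)) => //.
  move=> x Ux; rewrite deriveM //; apply: diff_derivable; [exact: dF|exact: dG].
by apply: Ck_onD => //; apply: IH.
Qed.

(** The derivative of the inverse is a polynomial in the inverse and the derivative of [F], so the
    induction on [k] keeps [F] fixed. [Ck_on_sqrt] follows the same pattern. *)
Lemma Ck_onV k U F : open U -> (forall x, U x -> F x != 0) ->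
  Ck_on k U F -> Ck_on k U (fun x => (F x)^-1).
Proof.
move=> oU nz; elim: k => [|k IH].
  by move=> cF x Ux; apply: continuousV; [exact: nz|exact: cF].
move=> CF1; have CF0 := Ck_onS _ _ _ CF1.
move: CF1 => /= [dF CF]; split=> [x Ux|j].
  by apply: differentiableV; [exact: dF|exact: nz].
apply: (Ck_on_ext _ _ (fun x => - ((F x)^-1 * (F x)^-1 * 'D_(delta_mx 0 j) F x))) => //.
  move=> x Ux; rewrite deriveV ?nz //; last by apply: diff_derivable; exact: dF.
  by rewrite -exprVn expr2 scaleNr.
apply: Ck_onN => //; apply: Ck_onM => //; apply: Ck_onM => //; exact: IH.
Qed.

Lemma differentiable_sqrt F x : 0 < F x -> differentiable F x ->
  differentiable (fun y => Num.sqrt (F y)) x.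
Proof.
move=> F0 dF; apply: (@differentiable_comp _ _ _ _ F Num.sqrt) => //.
by apply/derivable1_diffP; have [] := is_derive1_sqrt F0.
Qed.

Lemma Ck_on_sqrt k U F : open U -> (forall x, U x -> 0 < F x) ->
  Ck_on k U F -> Ck_on k U (fun x => Num.sqrt (F x)).
Proof.
move=> oU pos; elim: k => [|k IH].
  move=> cF x Ux; apply: (@continuous_comp _ _ _ F Num.sqrt); first exact: cF.
  exact: sqrt_continuous.
move=> CF1; have CF0 := Ck_onS _ _ _ CF1.
move: CF1 => /= [dF CF]; split=> [x Ux|j].
  by apply: differentiable_sqrt; [exact: pos|exact: dF].
apply: (Ck_on_ext _ _
  (fun x => (2 * Num.sqrt (F x))^-1 * 'D_(delta_mx 0 j) F x)) => //.
  move=> x Ux; have Fx := pos x Ux; have sF : Num.sqrt (F x) != 0.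
    by rewrite gt_eqF // sqrtr_gt0.
  have dS : derivable (fun y => Num.sqrt (F y)) x (delta_mx 0 j).
    apply: diff_derivable; apply: differentiable_sqrt => //; exact: dF.
  (* Near [x], [F] is the root times itself; the product rule for this product yields the derivative
     of the root. *)
  have -> : 'D_(delta_mx 0 j) F x =
            'D_(delta_mx 0 j) (fun y => Num.sqrt (F y) * Num.sqrt (F y)) x.
    apply: near_eq_derive.
    apply: filterS (open_nbhs_nbhs (conj oU Ux)) => y Uy.
    by rewrite -expr2 sqr_sqrtr // ltW // pos.
  by rewrite deriveM // /GRing.scale /=; field.
apply: Ck_onM => //; apply: Ck_onV => // [x Ux|].
  by rewrite mulf_neq0 // gt_eqF // sqrtr_gt0 pos.
apply: Ck_onM => //; [exact: Ck_on_cst|exact: IH].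
Unshelve. all: by end_near. Qed.

Lemma derive_coord (j i : 'I_n) x :
  'D_(delta_mx 0 j) (fun y : 'rV[R]_n => y 0 i) x = (i == j)%:R.
Proof.
apply: lim_near_cst => //; near=> h.
have h0 : h != 0 by near: h; exact: nbhs_dnbhs_neq.
by rewrite /= !mxE eqxx /= addrK /GRing.scale /= mulKf.
Unshelve. all: by end_near. Qed.

Lemma Ck_on_coord k U (i : 'I_n) : Ck_on k U (fun x => x 0 i).
Proof.
case: k => [|k] /=; first by move=> x _; exact: coord_continuous.
split=> [x _|j]; first exact: differentiable_coord.
under eq_fun do rewrite derive_coord.
exact: Ck_on_cst.
Qed.

End Ck.

(** * Complex-valued smooth functions *)

Section ReIm.
Context (R : realType).
Implicit Types a b : R[i].

Lemma cReD a b : complex.Re (a + b) = complex.Re a + complex.Re b.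
Proof. by case: a; case: b. Qed.
Lemma cImD a b : complex.Im (a + b) = complex.Im a + complex.Im b.
Proof. by case: a; case: b. Qed.
Lemma cReN a : complex.Re (- a) = - complex.Re a.
Proof. by case: a. Qed.
Lemma cImN a : complex.Im (- a) = - complex.Im a.
Proof. by case: a. Qed.
Lemma cReM a b : complex.Re (a * b) =
  complex.Re a * complex.Re b - complex.Im a * complex.Im b.
Proof. by case: a; case: b. Qed.
Lemma cImM a b : complex.Im (a * b) =
  complex.Re a * complex.Im b + complex.Im a * complex.Re b.
Proof. by case: a; case: b. Qed.
Lemma cReV a : complex.Re a^-1 =
  complex.Re a * (complex.Re a ^+ 2 + complex.Im a ^+ 2)^-1.
Proof. by case: a. Qed.
Lemma cImV a : complex.Im a^-1 =
  - (complex.Im a * (complex.Re a ^+ 2 + complex.Im a ^+ 2)^-1).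
Proof. by case: a. Qed.

Lemma complex_eq a b : complex.Re a = complex.Re b ->
  complex.Im a = complex.Im b -> a = b.
Proof. by case: a => ? ?; case: b => ? ? /= -> ->. Qed.

Lemma sqr_normc_neq0 a : a != 0 -> complex.Re a ^+ 2 + complex.Im a ^+ 2 != 0.
Proof.
case: a => x y; apply: contraNneq => /= /eqP.
by rewrite paddr_eq0 ?sqr_ge0 // !sqrf_eq0 => /andP[/eqP-> /eqP->].
Qed.

End ReIm.

Section smooth.
Context (R : realType) (n : nat).
Implicit Types (U : set 'rV[R]_n) (F G : 'rV[R]_n -> R[i]) (x v : 'rV[R]_n).

Definition cdifferentiable F x :=
  differentiable (fun y => complex.Re (F y)) x /\
  differentiable (fun y => complex.Im (F y)) x.

Lemma smooth_on_cdifferentiable U F x :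
  smooth_on U F -> U x -> cdifferentiable F x.
Proof. by move=> /(_ 1%N) [[dR _] [dI _]] Ux; split; [exact: dR|exact: dI]. Qed.

Lemma smooth_on_ext U F G : open U -> (forall x, U x -> F x = G x) ->
  smooth_on U F -> smooth_on U G.
Proof.
move=> oU FG sF k; have [CR CI] := sF k.
by split; [apply: Ck_on_ext CR|apply: Ck_on_ext CI] => // x /FG ->.
Qed.

Lemma smooth_on_sub U U' F : U' `<=` U -> smooth_on U F -> smooth_on U' F.
Proof. by move=> sU sF k; have [] := sF k; split; exact: Ck_on_sub sU _. Qed.

Lemma smooth_on_cst U (a : R[i]) : smooth_on U (fun=> a).
Proof. by move=> k; split; exact: Ck_on_cst. Qed.

Lemma smooth_on_real U (F : 'rV[R]_n -> R) : (forall k, Ck_on k U F) ->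
  smooth_on U (fun x => (F x)%:C).
Proof. by move=> CF k; split; [exact: CF|exact: Ck_on_cst]. Qed.

Lemma smooth_onD U F G : open U ->
  smooth_on U F -> smooth_on U G -> smooth_on U (fun x => F x + G x).
Proof.
move=> oU sF sG k; have [CR CI] := sF k; have [DR DI] := sG k.
under eq_fun do rewrite cReD; under [in X in _ /\ X]eq_fun do rewrite cImD.
by split; exact: Ck_onD.
Qed.

Lemma smooth_onN U F : open U -> smooth_on U F -> smooth_on U (fun x => - F x).
Proof.
move=> oU sF k; have [CR CI] := sF k.
under eq_fun do rewrite cReN; under [in X in _ /\ X]eq_fun do rewrite cImN.
by split; exact: Ck_onN.
Qed.

Lemma smooth_onM U F G : open U ->
  smooth_on U F -> smooth_on U G -> smooth_on U (fun x => F x * G x).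
Proof.
move=> oU sF sG k; have [CR CI] := sF k; have [DR DI] := sG k.
under eq_fun do rewrite cReM; under [in X in _ /\ X]eq_fun do rewrite cImM.
by split; apply: Ck_onD => //; [|apply: Ck_onN => //| |]; exact: Ck_onM.
Qed.

Lemma smooth_onX U F m : open U ->
  smooth_on U F -> smooth_on U (fun x => F x ^+ m).
Proof.
move=> oU sF; elim: m => [|m IH]; first exact: smooth_on_cst.
by under eq_fun do rewrite exprS; exact: smooth_onM.
Qed.

Lemma smooth_onV U F : open U -> (forall x, U x -> F x != 0) ->
  smooth_on U F -> smooth_on U (fun x => (F x)^-1).
Proof.
move=> oU nz sF k; have [CR CI] := sF k.
under eq_fun do rewrite cReV; under [in X in _ /\ X]eq_fun do rewrite cImV.
have CV : Ck_on k U (fun x => (complex.Re (F x) ^+ 2 + complex.Im (F x) ^+ 2)^-1).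
  apply: Ck_onV => // [x Ux|]; first exact/sqr_normc_neq0/nz.
  by apply: Ck_onD => //; exact: Ck_onM.
by split; [|apply: Ck_onN => //]; exact: Ck_onM.
Qed.

Lemma smooth_on_sum U (I : Type) (r : seq I) (P : pred I)
    (F : I -> 'rV[R]_n -> R[i]) : open U ->
  (forall i, P i -> smooth_on U (F i)) ->
  smooth_on U (fun x => \sum_(i <- r | P i) F i x).
Proof.
move=> oU sF; elim: r => [|i r IH].
  by under eq_fun do rewrite big_nil; exact: smooth_on_cst.
under eq_fun do rewrite big_cons; case: (boolP (P i)) => // Pi.
by apply: smooth_onD => //; exact: sF.
Qed.

Lemma smooth_on_prod U (I : Type) (r : seq I) (P : pred I)
    (F : I -> 'rV[R]_n -> R[i]) : open U ->
  (forall i, P i -> smooth_on U (F i)) ->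
  smooth_on U (fun x => \prod_(i <- r | P i) F i x).
Proof.
move=> oU sF; elim: r => [|i r IH].
  by under eq_fun do rewrite big_nil; exact: smooth_on_cst.
under eq_fun do rewrite big_cons; case: (boolP (P i)) => // Pi.
by apply: smooth_onM => //; exact: sF.
Qed.

Lemma smooth_on_det U m (M : 'rV[R]_n -> 'M[R[i]]_m) : open U ->
  (forall i j, smooth_on U (fun x => M x i j)) ->
  smooth_on U (fun x => \det (M x)).
Proof.
move=> oU sM; apply: smooth_on_sum => // s _.
apply: smooth_onM => //; first exact: smooth_on_cst.
exact: smooth_on_prod.
Qed.

(** By Cramer's rule an entry of the inverse is a cofactor divided by the determinant. *)
Lemma smooth_on_invmx U m (M : 'rV[R]_n -> 'M[R[i]]_m) i j : open U ->
  (forall i j, smooth_on U (fun x => M x i j)) ->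
  (forall x, U x -> M x \in unitmx) ->
  smooth_on U (fun x => invmx (M x) i j).
Proof.
move=> oU sM uM.
apply: (smooth_on_ext _ (fun x => (\det (M x))^-1 *
    ((-1) ^+ (j + i) * \det (row' j (col' i (M x)))))) => //.
  by move=> x /uM uMx; rewrite /invmx uMx !mxE.
apply: smooth_onM => //.
  by apply: smooth_onV => //; exact: smooth_on_det.
apply: smooth_onM => //; first exact: smooth_on_cst.
apply: smooth_on_det => // a b.
by apply: smooth_on_ext (sM (lift j a) (lift i b)) => // x _; rewrite !mxE.
Qed.

Lemma partial_ext j F G x : {near x, F =1 G} -> partial j F x = partial j G x.
Proof.
move=> FG; congr (_ +i* _); apply: near_eq_derive;
  by apply: filterS FG => y ->.
Qed.

Lemma partial_ext_on U j F G x : open U -> (forall y, U y -> F y = G y) ->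
  U x -> partial j F x = partial j G x.
Proof.
move=> oU FG Ux; apply: partial_ext.
by apply: filterS (open_nbhs_nbhs (conj oU Ux)) => y /FG.
Qed.

Lemma smooth_on_partial U j F : smooth_on U F -> smooth_on U (partial j F).
Proof.
move=> sF k; have [[_ CR] [_ CI]] := sF k.+1.
by split; [exact: CR|exact: CI].
Qed.

Lemma partial_cst j (a : R[i]) x : partial j (fun=> a) x = 0.
Proof. by rewrite /partial !derive_cst. Qed.

Lemma cdifferentiable_cst (a : R[i]) x : cdifferentiable (fun=> a) x.
Proof. by split; exact: differentiable_cst. Qed.

Lemma cdifferentiable_coord (i : 'I_n) x : cdifferentiable (fun y => (y 0 i)%:C) x.
Proof. by split; [exact: differentiable_coord|exact: differentiable_cst]. Qed.

Lemma smooth_on_coord U (i : 'I_n) : smooth_on U (fun y => (y 0 i)%:C).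
Proof. by apply: smooth_on_real => k; exact: Ck_on_coord. Qed.

Lemma partial_coord j (i : 'I_n) x : partial j (fun y => (y 0 i)%:C) x = (i == j)%:R.
Proof.
rewrite /partial /= derive_cst derive_coord; by case: (i == j).
Qed.

Lemma cdifferentiableD F G x : cdifferentiable F x -> cdifferentiable G x ->
  cdifferentiable (fun y => F y + G y) x.
Proof.
move=> [dR dI] [eR eI]; split.
  by under eq_fun do rewrite cReD; exact: differentiableD.
by under eq_fun do rewrite cImD; exact: differentiableD.
Qed.

Lemma cdifferentiableN F x : cdifferentiable F x ->
  cdifferentiable (fun y => - F y) x.
Proof.
move=> [dR dI]; split.
  by under eq_fun do rewrite cReN; exact: differentiableN.
by under eq_fun do rewrite cImN; exact: differentiableN.
Qed.

Lemma cdifferentiableM F G x : cdifferentiable F x -> cdifferentiable G x ->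
  cdifferentiable (fun y => F y * G y) x.
Proof.
move=> [dR dI] [eR eI]; split.
  under eq_fun do rewrite cReM.
  by apply: differentiableB; exact: differentiableM.
by under eq_fun do rewrite cImM; apply: differentiableD; exact: differentiableM.
Qed.

Lemma partialD j F G x : cdifferentiable F x -> cdifferentiable G x ->
  partial j (fun y => F y + G y) x = partial j F x + partial j G x.
Proof.
move=> [dR dI] [eR eI]; rewrite /partial.
under eq_fun do rewrite cReD; under [X in _ +i* 'D__ X _]eq_fun do rewrite cImD.
by rewrite !deriveD //; exact: diff_derivable.
Qed.

Lemma partialN j F x : cdifferentiable F x ->
  partial j (fun y => - F y) x = - partial j F x.
Proof.
move=> [dR dI]; rewrite /partial.
under eq_fun do rewrite cReN; under [X in _ +i* 'D__ X _]eq_fun do rewrite cImN.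
by rewrite !deriveN //; exact: diff_derivable.
Qed.

Lemma partialM j F G x : cdifferentiable F x -> cdifferentiable G x ->
  partial j (fun y => F y * G y) x = partial j F x * G x + F x * partial j G x.
Proof.
move=> [dR dI] [eR eI]; rewrite /partial.
under eq_fun do rewrite cReM; under [X in _ +i* 'D__ X _]eq_fun do rewrite cImM.
have dv (f : 'rV[R]_n -> R) (y : 'rV[R]_n) :
    differentiable f y -> derivable f y (delta_mx 0 j).
  by move=> ?; exact: diff_derivable.
have dM (f g : 'rV[R]_n -> R) : differentiable f x -> differentiable g x ->
    'D_(delta_mx 0 j) (fun y : 'rV[R]_n => f y * g y : R) x =
    'D_(delta_mx 0 j) f x * g x + f x * 'D_(delta_mx 0 j) g x.
  move=> df dg; rewrite deriveM; [|exact: dv|exact: dv].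
  by rewrite addrC /GRing.scale /=; congr (_ + _); rewrite mulrC.
rewrite deriveB; [|by apply: dv; exact: differentiableM..].
rewrite deriveD; [|by apply: dv; exact: differentiableM..].
rewrite !dM //; case: (F x) => a b; case: (G x) => c d.
by apply: complex_eq; rewrite ?cReD ?cImD ?cReM ?cImM /=; ring.
Qed.

Lemma cdifferentiable_sum (I : Type) (r : seq I) (P : pred I)
    (F : I -> 'rV[R]_n -> R[i]) x :
  (forall i, P i -> cdifferentiable (F i) x) ->
  cdifferentiable (fun y => \sum_(i <- r | P i) F i y) x.
Proof.
move=> dF; elim: r => [|i r IH].
  by under eq_fun do rewrite big_nil; exact: cdifferentiable_cst.
under eq_fun do rewrite big_cons; case: (boolP (P i)) => // Pi.
by apply: cdifferentiableD => //; exact: dF.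
Qed.

Lemma partial_sum j (I : Type) (r : seq I) (P : pred I)
    (F : I -> 'rV[R]_n -> R[i]) x :
  (forall i, P i -> cdifferentiable (F i) x) ->
  partial j (fun y => \sum_(i <- r | P i) F i y) x =
  \sum_(i <- r | P i) partial j (F i) x.
Proof.
move=> dF; elim: r => [|i r IH].
  by under eq_fun do rewrite big_nil; rewrite big_nil partial_cst.
under eq_fun do rewrite big_cons; rewrite big_cons; case: (boolP (P i)) => // Pi.
rewrite partialD ?IH //; first exact: dF.
exact: cdifferentiable_sum.
Qed.

End smooth.

Arguments cdifferentiable {R n}.

(** * Pullbacks and the principal square root *)

Section pullback.
Context (R : realType) (n1 n2 : nat).
Implicit Types (U : set 'rV[R]_n1) (F : 'rV[R]_n1 -> R) (x v : 'rV[R]_(n1 + n2)).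

(** The projection is linear, so the two difference quotients are the same function of the step. *)
Lemma derive_lsubmx F x v :
  'D_v (fun y => F (lsubmx y)) x = 'D_(lsubmx v) F (lsubmx x).
Proof.
have lE (h : R) : lsubmx (h *: v + x) = h *: lsubmx v + lsubmx x.
  by apply/rowP => j; rewrite !mxE.
by rewrite /derive; under eq_fun do rewrite /= lE.
Qed.

Lemma lsubmx_delta_l (i : 'I_n1) :
  lsubmx (delta_mx 0 (lshift n2 i)) = delta_mx 0 i :> 'rV[R]_n1.
Proof. by apply/rowP => j; rewrite !mxE eqxx /= eq_lshift. Qed.

Lemma lsubmx_delta_r (i : 'I_n2) :
  lsubmx (delta_mx 0 (rshift n1 i)) = 0 :> 'rV[R]_n1.
Proof. by apply/rowP => j; rewrite !mxE eqxx /= eq_lrshift. Qed.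

Lemma Ck_on_lsubmx k U F : Ck_on k U F ->
  Ck_on k [set x : 'rV[R]_(n1 + n2) | U (lsubmx x)] (fun x => F (lsubmx x)).
Proof.
elim: k F => [|k IH] F /=.
  move=> cF x Ux; apply: (@continuous_comp _ _ _ lsubmx F).
    exact: continuous_lsubmx.
  exact: cF.
move=> [dF CF]; split=> [x Ux|j].
  apply: (@differentiable_comp _ _ _ _ lsubmx F); first exact: differentiable_lsubmx.
  exact: dF.
rewrite (_ : (fun x => _) = fun x => 'D_(lsubmx (delta_mx 0 j)) F (lsubmx x)).
  case: (split_ordP j) => i ->; first by rewrite lsubmx_delta_l; exact: (IH _ (CF i)).
  rewrite lsubmx_delta_r (_ : (fun x => _) = fun=> 0); first exact: Ck_on_cst.
  by apply/funext => x; exact: derive0.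
by apply/funext => x; rewrite derive_lsubmx.
Qed.

Lemma smooth_on_lsubmx U (F : 'rV[R]_n1 -> R[i]) : smooth_on U F ->
  smooth_on [set x : 'rV[R]_(n1 + n2) | U (lsubmx x)] (fun x => F (lsubmx x)).
Proof.
move=> sF k; have [CR CI] := sF k.
by split; [exact: (Ck_on_lsubmx _ _ _ CR)|exact: (Ck_on_lsubmx _ _ _ CI)].
Qed.

Lemma partial_lsubmx_l (i : 'I_n1) (F : 'rV[R]_n1 -> R[i]) x :
  partial (lshift n2 i) (fun y => F (lsubmx y)) x = partial i F (lsubmx x).
Proof.
rewrite /partial (derive_lsubmx (fun y => complex.Re (F y))).
by rewrite (derive_lsubmx (fun y => complex.Im (F y))) lsubmx_delta_l.
Qed.

Lemma partial_lsubmx_r (i : 'I_n2) (F : 'rV[R]_n1 -> R[i]) x :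
  partial (rshift n1 i) (fun y => F (lsubmx y)) x = 0.
Proof.
rewrite /partial (derive_lsubmx (fun y => complex.Re (F y))).
by rewrite (derive_lsubmx (fun y => complex.Im (F y))) lsubmx_delta_r !derive0.
Qed.

Lemma open_lsubmx U : open U -> open [set x : 'rV[R]_(n1 + n2) | U (lsubmx x)].
Proof.
move=> oU; rewrite (_ : [set x | _] = lsubmx @^-1` U) //.
by apply: open_comp => // x _; exact: continuous_lsubmx.
Qed.

End pullback.

(** * Smoothness of the principal square root on the slit plane *)

Section sqrtc.
Context (R : realType).
Implicit Types z : R[i].

(** The quantity |z| + Re z is twice the square of the real part of [sqrtc z]. It is positive
    exactly off the nonpositive reals, and it is continuous, which also makes the slit plane
    open. *)
Lemma slit_planeP z : reflect
  (0 < Num.sqrt (complex.Re z ^+ 2 + complex.Im z ^+ 2) + complex.Re z)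
  (~~ (z <= 0)).
Proof.
apply: (iffP idP); case: z => a b; rewrite lecE /=; last first.
  apply: contraTN => /andP[/eqP<- a0]; rewrite expr0n addr0 sqrtr_sqr.
  by rewrite ler0_norm // addNr ltxx.
have [->|b0 _] := eqVneq b 0.
  rewrite /= -ltNge => a0; rewrite expr0n addr0 sqrtr_sqr gtr0_norm //.
  exact: addr_gt0.
rewrite -ltrBlDr sub0r (le_lt_trans (ler_norm _)) // normrN -sqrtr_sqr.
by rewrite ltr_sqrt ?ltrDl ?exprn_even_gt0 // ltr_wpDl ?sqr_ge0 ?exprn_even_gt0.
Qed.

Lemma Re_sqrtc z : complex.Re (sqrtc z) =
  Num.sqrt ((Num.sqrt (complex.Re z ^+ 2 + complex.Im z ^+ 2) + complex.Re z) / 2).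
Proof. by case: z. Qed.

(** Compare imaginary parts in w ^ 2 = z with w = [sqrtc z]. This quotient is smooth on the whole
    slit plane, whereas the root of (|z| - Re z) / 2 has a vanishing radicand on the positive
    reals. *)
Lemma Im_sqrtc z : ~~ (z <= 0) ->
  complex.Im (sqrtc z) = complex.Im z / (2 * complex.Re (sqrtc z)).
Proof.
move=> /slit_planeP zP.
have s0 : complex.Re (sqrtc z) != 0.
  by rewrite gt_eqF // Re_sqrtc sqrtr_gt0 divr_gt0.
by rewrite -{2}(sqr_sqrtc z) expr2 cImM; field.
Qed.

Context (n : nat).
Implicit Types (U : set 'rV[R]_n) (F : 'rV[R]_n -> R[i]).

Lemma smooth_on_sqrtc U F : open U -> (forall x, U x -> ~~ (F x <= 0)) ->
  smooth_on U F -> smooth_on U (fun x => sqrtc (F x)).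
Proof.
move=> oU FU sF k; have [CR CI] := sF k.
have F0 x : U x -> F x != 0 by move=> /FU; apply: contraNneq => ->.
have CRs : Ck_on k U (fun x => complex.Re (sqrtc (F x))).
  under eq_fun do rewrite Re_sqrtc.
  apply: Ck_on_sqrt => // [x Ux|].
    by rewrite divr_gt0 //; apply/slit_planeP/FU.
  apply: Ck_onM => //; last exact: Ck_on_cst.
  apply: Ck_onD => //; apply: Ck_on_sqrt => // [x Ux|].
    by rewrite lt_neqAle eq_sym sqr_normc_neq0 ?F0 // addr_ge0 ?sqr_ge0.
  by apply: Ck_onD => //; exact: Ck_onM.
split=> //; apply: (Ck_on_ext _ _ _ _
  (fun x => complex.Im (F x) * (2 * complex.Re (sqrtc (F x)))^-1)) => //.
  by move=> x Ux; rewrite [RHS]Im_sqrtc // FU.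
apply: Ck_onM => //; apply: Ck_onV => // [x Ux|]; last first.
  by apply: Ck_onM => //; exact: Ck_on_cst.
rewrite mulf_neq0 // gt_eqF // Re_sqrtc sqrtr_gt0 divr_gt0 //.
exact/slit_planeP/FU.
Qed.

Lemma open_slit_plane F : smooth_on setT F -> open [set x | ~~ (F x <= 0)].
Proof.
move=> sF; have [cR cI] := sF 0%N.
pose f x := complex.Re (F x) ^+ 2 + complex.Im (F x) ^+ 2.
have cf (x : 'rV[R]_n) : {for x, continuous f}.
  by apply: continuousD; [have c := cR x I|have c := cI x I]; exact: continuousM.
have cN (x : 'rV[R]_n) :
    {for x, continuous (fun x => Num.sqrt (f x) + complex.Re (F x))}.
  apply: continuousD; last exact: cR.
  by apply: (@continuous_comp _ _ _ f Num.sqrt) => //; exact: sqrt_continuous.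
rewrite (_ : [set x | _] =
    (fun x => Num.sqrt (f x) + complex.Re (F x)) @^-1` [set r | 0 < r]).
  by apply: open_comp; [move=> x _; exact: cN|exact: open_gt].
by apply/seteqP; split=> x /= /slit_planeP.
Qed.

End sqrtc.

(** * A calculus of partial derivatives *)

Section is_partial.
Context (R : realType) (n : nat) (j : 'I_n) (x : 'rV[R]_n).
Implicit Types (F G : 'rV[R]_n -> R[i]) (a b d : R[i]).

(** Differentiability and the value of the derivative travel together, so the rules compose without
    side conditions and a derivative can be synthesized from the syntax of the function. *)
Definition is_partial F a := cdifferentiable F x /\ partial j F x = a.

(** The value [a] is left as an existential variable for [partial_tac] to fill; the remaining
    equation compares it with the intended closed form. *)
Lemma is_partial_eq F a b : is_partial F a -> a = b -> is_partial F b.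
Proof. by move=> ? <-. Qed.

Lemma is_partial_self F : cdifferentiable F x -> is_partial F (partial j F x).
Proof. by []. Qed.

Lemma is_partial_cst a : is_partial (fun=> a) 0.
Proof. by split; [exact: cdifferentiable_cst|exact: partial_cst]. Qed.

Lemma is_partialD F G a b : is_partial F a -> is_partial G b ->
  is_partial (fun y => F y + G y) (a + b).
Proof.
by move=> [dF <-] [dG <-]; split; [exact: cdifferentiableD|exact: partialD].
Qed.

Lemma is_partialN F a : is_partial F a -> is_partial (fun y => - F y) (- a).
Proof.
by move=> [dF <-]; split; [exact: cdifferentiableN|exact: partialN].
Qed.

Lemma is_partialM F G a b : is_partial F a -> is_partial G b ->
  is_partial (fun y => F y * G y) (a * G x + F x * b).
Proof.
by move=> [dF <-] [dG <-]; split; [exact: cdifferentiableM|exact: partialM].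
Qed.

Lemma is_partial_sqr F a : is_partial F a ->
  is_partial (fun y => F y ^+ 2) (2 * F x * a).
Proof.
move=> Fa; apply: is_partial_eq (is_partialM _ _ _ _ Fa Fa) _.
by ring.
Qed.

Lemma is_partial_sum (I : Type) (r : seq I) (F : I -> 'rV[R]_n -> R[i])
    (a : I -> R[i]) : (forall i, is_partial (F i) (a i)) ->
  is_partial (fun y => \sum_(i <- r) F i y) (\sum_(i <- r) a i).
Proof.
move=> Fa; have dF i : cdifferentiable (F i) x by case: (Fa i).
split; first exact: cdifferentiable_sum.
by rewrite partial_sum //; apply: eq_bigr => i _; case: (Fa i).
Qed.

End is_partial.

Arguments is_partial {R n}.

(** * The eigenvalues and their derivatives *)

Lemma ord2P (j : 'I_2) : j = 0 \/ j = 1.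
Proof. by case: j => [[|[|//]] ?]; [left|right]; apply: val_inj. Qed.

Lemma sum_ord2 (V : nmodType) (F : 'I_2 -> V) : \sum_(i < 2) F i = F 0 + F 1.
Proof.
rewrite !big_ord_recl big_ord0 addr0; congr (F _ + F _); exact: val_inj.
Qed.

Lemma det_mx2 (K : comRingType) (M : 'M[K]_2) :
  \det M = M 0 0 * M 1 1 - M 0 1 * M 1 0.
Proof.
rewrite (expand_det_row _ 0) sum_ord2 /cofactor !det_mx11 !mxE /=.
have -> : lift 0 0 = 1 :> 'I_2 by exact: val_inj.
have -> : lift 1 0 = 0 :> 'I_2 by exact: val_inj.
by rewrite expr0 expr1; ring.
Qed.

(* The match is syntactic because unification would unfold the ring operations
   of R[i]. *)
Ltac partial_tac :=
  lazymatch goal with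
  | |- is_partial _ _ (fun=> ?a) _ => eapply is_partial_cst
  | |- is_partial _ _ (fun y => - @?F y) _ =>
      eapply (is_partialN _ _ _ _ F); partial_tac
  | |- is_partial _ _ (fun y => @?F y + @?G y) _ =>
      eapply (is_partialD _ _ _ _ F G); partial_tac
  | |- is_partial _ _ (fun y => @?F y * @?G y) _ =>
      eapply (is_partialM _ _ _ _ F G); partial_tac
  | |- is_partial _ _ (fun y => @?F y ^+ 2) _ =>
      eapply (is_partial_sqr _ _ _ _ F); partial_tac
  | |- is_partial _ _ ?F _ =>
      let F' := eval cbv beta in (fun y => F y) in
      match goal with H : is_partial _ _ ?G _ |- _ =>
        let G' := eval cbv beta in (fun y => G y) in
        constr_eq F' G'; exact H
      end
  end.

Ltac smooth_tac :=
  lazymatch goal with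
  | |- open _ => assumption
  | |- smooth_on _ (fun=> ?a) => apply: smooth_on_cst
  | |- smooth_on _ (fun y => - @?F y) =>
      apply: (smooth_onN _ _ _ F); smooth_tac
  | |- smooth_on _ (fun y => @?F y + @?G y) =>
      apply: (smooth_onD _ _ _ F G); smooth_tac
  | |- smooth_on _ (fun y => @?F y * @?G y) =>
      apply: (smooth_onM _ _ _ F G); smooth_tac
  | |- smooth_on _ (fun y => @?F y ^+ ?m) =>
      apply: (smooth_onX _ _ _ F m); smooth_tac
  | |- _ => try assumption
  end.

Section Ell.
Context (R : realType) (g2 k1 k2 : R[i]).
Implicit Types (q : 'rV[R]_2) (i j k l : 'I_2).

Lemma is_partial_crd j i q : is_partial j q (fun y => crd y i) (i == j)%:R.
Proof. by split; [exact: cdifferentiable_coord|exact: partial_coord]. Qed.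

Definition dellT j q : R[i] :=
  if j == 0 then 2 * g2 * crd q 0 else 2 * g2 * k1 ^+ 2 * crd q 1.

Definition dellP j q : R[i] :=
  if j == 0 then 0 else 2 * g2 * k1 ^+ 2 * k2 ^+ 2 * crd q 1.

Lemma is_partial_ellT j q : is_partial j q (ellT g2 k1 k2) (dellT j q).
Proof.
have c0 := is_partial_crd j 0 q; have c1 := is_partial_crd j 1 q.
eapply is_partial_eq; first by rewrite /ellT; partial_tac.
by rewrite /dellT; case: (ord2P j) => -> /=; ring.
Qed.

Lemma is_partial_ellP j q : is_partial j q (ellP g2 k1 k2) (dellP j q).
Proof.
have c1 := is_partial_crd j 1 q.
eapply is_partial_eq; first by rewrite /ellP; partial_tac.
by rewrite /dellP; case: (ord2P j) => -> /=; ring.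
Qed.

(** T and P contain no mixed terms, so their Hessians are constant and diagonal. The first
    derivatives are linear in one coordinate, and evaluation at the all-ones vector extracts the
    coefficient. *)
Definition d2ellT j k : R[i] := if j == k then dellT j (const_mx 1) else 0.
Definition d2ellP j k : R[i] := if j == k then dellP j (const_mx 1) else 0.

Lemma is_partial_dellT j k q : is_partial k q (dellT j) (d2ellT j k).
Proof.
have c0 := is_partial_crd k 0 q; have c1 := is_partial_crd k 1 q.
rewrite /d2ellT /dellT.
by case: (ord2P j) => -> /=; (eapply is_partial_eq; first by partial_tac);
  case: (ord2P k) => -> /=; rewrite /crd ?mxE; ring.
Qed.

Lemma is_partial_dellP j k q : is_partial k q (dellP j) (d2ellP j k).
Proof.
have c0 := is_partial_crd k 0 q; have c1 := is_partial_crd k 1 q.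
rewrite /d2ellP /dellP.
by case: (ord2P j) => -> /=; (eapply is_partial_eq; first by partial_tac);
  case: (ord2P k) => -> /=; rewrite /crd ?mxE; ring.
Qed.

Lemma smooth_on_crd (U : set 'rV[R]_2) i : smooth_on U (fun q => crd q i).
Proof. exact: smooth_on_coord. Qed.

Lemma smooth_ellT (U : set 'rV[R]_2) : open U -> smooth_on U (ellT g2 k1 k2).
Proof.
move=> oU; have c0 := smooth_on_crd U 0; have c1 := smooth_on_crd U 1.
by rewrite /ellT; smooth_tac.
Qed.

Lemma smooth_ellP (U : set 'rV[R]_2) : open U -> smooth_on U (ellP g2 k1 k2).
Proof.
move=> oU; have c0 := smooth_on_crd U 0; have c1 := smooth_on_crd U 1.
by rewrite /ellP; smooth_tac.
Qed.

Lemma smooth_discr (U : set 'rV[R]_2) : open U -> smooth_on U (discr g2 k1 k2).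
Proof.
move=> oU; apply: smooth_onD => //.
  by apply: smooth_onX => //; exact: smooth_ellT.
apply: smooth_onN => //; apply: smooth_onM => //; first exact: smooth_on_cst.
exact: smooth_ellP.
Qed.

(** The two clauses of [off_focal] together place the discriminant in the slit plane, where the root
    is smooth. *)
Lemma off_focalE : off_focal g2 k1 k2 = [set q | ~~ (discr g2 k1 k2 q <= 0)].
Proof.
rewrite /off_focal /ellS; apply/seteqP; split=> q /=; rewrite sqrtc_eq0 le_eqVlt negb_or.
  by move=> [-> ->].
by move=> /andP[].
Qed.

Lemma open_off_focal : open (off_focal g2 k1 k2).
Proof. by rewrite off_focalE; exact/open_slit_plane/smooth_discr/openT. Qed.

Lemma smooth_ellS : smooth_on (off_focal g2 k1 k2) (ellS g2 k1 k2).
Proof.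
apply: smooth_on_sqrtc; first exact: open_off_focal.
  by rewrite off_focalE.
exact/smooth_discr/open_off_focal.
Qed.

Lemma smooth_lam1 : smooth_on (off_focal g2 k1 k2) (lam1 g2 k1 k2).
Proof.
have oU := open_off_focal.
apply: smooth_onM => //; first exact: smooth_on_cst.
by apply: smooth_onD => //; [exact: smooth_ellT|exact: smooth_ellS].
Qed.

Lemma smooth_lam2 : smooth_on (off_focal g2 k1 k2) (lam2 g2 k1 k2).
Proof.
have oU := open_off_focal.
apply: smooth_onM => //; first exact: smooth_on_cst.
apply: smooth_onD => //; first exact: smooth_ellT.
by apply: smooth_onN => //; exact: smooth_ellS.
Qed.

Lemma lam_0 q : lam g2 k1 k2 q 0 0 = lam1 g2 k1 k2 q.
Proof. by rewrite mxE. Qed.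

Lemma lam_1 q : lam g2 k1 k2 q 1 0 = lam2 g2 k1 k2 q.
Proof. by rewrite mxE. Qed.

Lemma lamD q : lam1 g2 k1 k2 q + lam2 g2 k1 k2 q = ellT g2 k1 k2 q.
Proof. by rewrite /lam1 /lam2; field. Qed.

Lemma lamB q : lam1 g2 k1 k2 q - lam2 g2 k1 k2 q = ellS g2 k1 k2 q.
Proof. by rewrite /lam1 /lam2; field. Qed.

Lemma ellS_sqr q : ellS g2 k1 k2 q ^+ 2 = discr g2 k1 k2 q.
Proof. exact: sqr_sqrtc. Qed.

Lemma lamM q : lam1 g2 k1 k2 q * lam2 g2 k1 k2 q = ellP g2 k1 k2 q.
Proof.
transitivity ((ellT g2 k1 k2 q ^+ 2 - ellS g2 k1 k2 q ^+ 2) / 4).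
  by rewrite /lam1 /lam2; field.
by rewrite ellS_sqr /discr; field.
Qed.

Local Notation L i := (fun q => lam g2 k1 k2 q i 0).

Lemma smooth_lam i : smooth_on (off_focal g2 k1 k2) (L i).
Proof.
case: (ord2P i) => ->.
  by under eq_fun do rewrite lam_0; exact: smooth_lam1.
by under eq_fun do rewrite lam_1; exact: smooth_lam2.
Qed.

(* This is S for i = 0 and - S for i = 1. *)
Definition lamR i q : R[i] := 2 * lam g2 k1 k2 q i 0 - ellT g2 k1 k2 q.

Lemma lamR_neq0 i q : off_focal g2 k1 k2 q -> lamR i q != 0.
Proof.
move=> [S0 _]; have <- : (-1) ^+ i * ellS g2 k1 k2 q = lamR i q.
  rewrite -lamB /lamR -lamD; case: (ord2P i) => ->.
    by rewrite lam_0; ring.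
  by rewrite lam_1; ring.
by rewrite mulf_neq0 // signr_eq0.
Qed.

Lemma lam_root i q :
  lam g2 k1 k2 q i 0 ^+ 2 = ellT g2 k1 k2 q * lam g2 k1 k2 q i 0 - ellP g2 k1 k2 q.
Proof.
by rewrite -lamD -lamM; case: (ord2P i) => ->; rewrite ?lam_0 ?lam_1; ring.
Qed.

Local Notation J := (Jmx g2 k1 k2).

Lemma is_partial_lam i j q : off_focal g2 k1 k2 q ->
  is_partial j q (L i) (J q i j).
Proof.
move=> Uq; rewrite mxE; apply: is_partial_self.
exact: smooth_on_cdifferentiable (smooth_lam i) Uq.
Qed.

Lemma smooth_J i j : smooth_on (off_focal g2 k1 k2) (fun q => J q i j).
Proof.
by under eq_fun do rewrite mxE; apply: smooth_on_partial; exact: smooth_lam.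
Qed.

Lemma J_lam i j q : off_focal g2 k1 k2 q ->
  lamR i q * J q i j = lam g2 k1 k2 q i 0 * dellT j q - dellP j q.
Proof.
move=> Uq; have dl := is_partial_lam i j q Uq.
have dT := is_partial_ellT j q; have dP := is_partial_ellP j q.
have [_ e1] : is_partial j q (fun y => lam g2 k1 k2 y i 0 ^+ 2)
   (2 * lam g2 k1 k2 q i 0 * J q i j) by exact: is_partial_sqr.
have [_] : is_partial j q
    (fun y => ellT g2 k1 k2 y * lam g2 k1 k2 y i 0 - ellP g2 k1 k2 y)
    (dellT j q * lam g2 k1 k2 q i 0 + ellT g2 k1 k2 q * J q i j - dellP j q).
  by partial_tac.
under eq_fun do rewrite -lam_root; rewrite e1 /lamR => e2.
by rewrite mulrBl e2; ring.
Qed.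

Definition hess i q : 'M[R[i]]_2 := \matrix_(j, k) partial j (fun y => J y i k) q.

Lemma is_partial_J i j k q : off_focal g2 k1 k2 q ->
  is_partial j q (fun y => J y i k) (hess i q j k).
Proof.
move=> Uq; rewrite mxE; apply: is_partial_self.
exact: smooth_on_cdifferentiable (smooth_J i k) Uq.
Qed.

(** [J_lam] holds on an open set, so it can be differentiated once more. The right side is symmetric
    in [j] and [k], which is the source of [hess_sym]. *)
Lemma hess_lam i j k q : off_focal g2 k1 k2 q ->
  lamR i q * hess i q j k =
    J q i j * dellT k q + J q i k * dellT j q - 2 * J q i j * J q i k
    + lam g2 k1 k2 q i 0 * d2ellT k j - d2ellP k j.
Proof.
move=> Uq; have dl := is_partial_lam i j q Uq.
have dJ := is_partial_J i j k q Uq.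
have dT := is_partial_ellT j q; have dP := is_partial_ellP j q.
have dT2 := is_partial_dellT k j q; have dP2 := is_partial_dellP k j q.
have [_ e1] : is_partial j q (fun y => lamR i y * J y i k)
   ((2 * J q i j - dellT j q) * J q i k + lamR i q * hess i q j k).
  by eapply is_partial_eq; [rewrite /lamR; partial_tac|rewrite /lamR; ring].
have [_ e2] : is_partial j q
    (fun y => lam g2 k1 k2 y i 0 * dellT k y - dellP k y)
    (J q i j * dellT k q + lam g2 k1 k2 q i 0 * d2ellT k j - d2ellP k j).
  by partial_tac.
have := partial_ext_on _ _ _ _ _ _ _ open_off_focal (fun y => J_lam i k y) Uq.
by move=> /(_ j); rewrite e1 e2 => /(canRL (addKr _)) ->; ring.
Qed.

Lemma hess_sym i j k q : off_focal g2 k1 k2 q -> hess i q j k = hess i q k j.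
Proof.
move=> Uq; apply: (mulfI (lamR_neq0 i q Uq)); rewrite !hess_lam //.
have -> : d2ellT k j = d2ellT j k.
  by rewrite /d2ellT eq_sym; case: eqP => [->|].
have -> : d2ellP k j = d2ellP j k.
  by rewrite /d2ellP eq_sym; case: eqP => [->|].
by ring.
Qed.

(** The rows of J are l1 dT - dP over S and l2 dT - dP over - S, whose wedge is dT /\ dP over S. As
    dP has only a q2 component, this is the product of [dellT 0] and [dellP 1] over S. *)
Lemma det_J q : off_focal g2 k1 k2 q -> ellS g2 k1 k2 q * \det (J q) =
  4 * g2 ^+ 2 * k1 ^+ 2 * k2 ^+ 2 * crd q 0 * crd q 1.
Proof.
move=> Uq; have r0 := lamR_neq0 0 q Uq; have r1 := lamR_neq0 1 q Uq.
rewrite det_mx2.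
have a00 := J_lam 0 0 q Uq; have a01 := J_lam 0 1 q Uq.
have a10 := J_lam 1 0 q Uq; have a11 := J_lam 1 1 q Uq.
(* The factor is - S ^ 2; it pairs each entry of J with the [lamR] of its row, so that [J_lam]
   applies. *)
apply: (mulfI (mulf_neq0 r0 r1)).
transitivity (ellS g2 k1 k2 q *
  ((lamR 0 q * J q 0 0) * (lamR 1 q * J q 1 1) -
   (lamR 0 q * J q 0 1) * (lamR 1 q * J q 1 0))); first by ring.
rewrite a00 a01 a10 a11 /lamR /dellT /dellP !lam_0 !lam_1 /= -lamD -lamB.
by ring.
Qed.

End Ell.

(** * The Nijenhuis operator *)

Lemma ord4P (i : 'I_(2 + 2)) :
  [\/ i = lshift 2 0, i = lshift 2 1, i = rshift 2 0 | i = rshift 2 1].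
Proof.
by case: (split_ordP i) => j ->; case: (ord2P j) => ->;
  [apply: Or41|apply: Or42|apply: Or43|apply: Or44].
Qed.

Lemma sum_ord4 (V : nmodType) (F : 'I_(2 + 2) -> V) : \sum_(i < 2 + 2) F i =
  F (lshift 2 0) + F (lshift 2 1) + (F (rshift 2 0) + F (rshift 2 1)).
Proof. by rewrite big_split_ord !sum_ord2. Qed.

Lemma addmxE (V : nmodType) m n (A B : 'M[V]_(m, n)) i j :
  (A + B) i j = A i j + B i j.
Proof. by rewrite mxE. Qed.

Lemma oppmxE (V : zmodType) m n (A : 'M[V]_(m, n)) i j : (- A) i j = - A i j.
Proof. by rewrite mxE. Qed.

(** The torsion at one point, as matrix algebra: [C] and [D] stand for the Jacobians of the fields,
    [A] and [B] for the derivative of the tensor applied to them, and [A + L *m C] is the product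
    rule. *)
Lemma torsion_identity (K : comRingType) n (L A B C D : 'M[K]_n) (X Y : 'cV_n) :
  L *m (L *m (D *m X - C *m Y))
  + ((B + L *m D) *m (L *m X) - (A + L *m C) *m (L *m Y))
  - L *m ((B + L *m D) *m X - C *m (L *m Y) +
          (D *m (L *m X) - (A + L *m C) *m Y)) =
  B *m (L *m X) - A *m (L *m Y) - L *m (B *m X) + L *m (A *m Y).
Proof.
rewrite !(mulmxDr, mulmxDl, mulmxN, mulNmx) !mulmxA.
apply/matrixP => i j; rewrite !(addmxE, oppmxE).
(* The letters [a], [b], [d], [f] are the products that contain [C] or [D]; they cancel in pairs. *)
have cancel (a b c d e f g h : K) :
  a - b + (c + d - (e + f)) - (g + a - f + (d - (h + b))) = c - e - g + h by ring.
exact: cancel.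
Qed.

Section Torsion.
Context (R : realType) (L : tensor11 R).
Hypothesis sL : forall i j, smooth_on setT (fun x => L x i j).

Definition dtensor (j : 'I_(2 + 2)) (x : 'rV[R]_(2 + 2)) : 'M[R[i]]_(2 + 2) :=
  \matrix_(i, m) partial j (fun y => L y i m) x.

(** The part of the Jacobian of [app L X] in which only [L] is differentiated; column [j] belongs to
    the j-th direction. *)
Definition dtensor_app (X : vfield R) (x : 'rV[R]_(2 + 2)) : 'M[R[i]]_(2 + 2) :=
  \matrix_(i, j) (dtensor j x *m X x) i 0.

Lemma jac_app (X : vfield R) x : smooth_vfield X ->
  jac (app L X) x = dtensor_app X x + L x *m jac X x.
Proof.
move=> sX; apply/matrixP => i j; rewrite [LHS]mxE [RHS]mxE.
have -> : (fun y => app L X y i 0) = fun y => \sum_m L y i m * X y m 0.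
  by apply/funext => y; rewrite mxE.
have iL m : is_partial j x (fun y => L y i m) (dtensor j x i m).
  rewrite [dtensor j x i m]mxE; apply: is_partial_self.
  exact: smooth_on_cdifferentiable (sL i m) I.
have iX m : is_partial j x (fun y => X y m 0) (jac X x m j).
  rewrite [jac X x m j]mxE; apply: is_partial_self.
  exact: smooth_on_cdifferentiable (sX m) I.
have [_ ->] := is_partial_sum _ _ _ _ _ (index_enum _) _ _
  (fun m => is_partialM _ _ _ _ _ _ _ _ (iL m) (iX m)).
by rewrite big_split [dtensor_app _ _ _ _]mxE !mxE.
Qed.

(* The derivatives of X and Y cancel: the torsion is tensorial. *)
Lemma torsionE (X Y : vfield R) x : smooth_vfield X -> smooth_vfield Y ->
  app L (app L (lie X Y)) x + lie (app L X) (app L Y) x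
  - app L (fun y => lie X (app L Y) y + lie (app L X) Y y) x =
  dtensor_app Y x *m (L x *m X x) - dtensor_app X x *m (L x *m Y x)
  - L x *m (dtensor_app Y x *m X x) + L x *m (dtensor_app X x *m Y x).
Proof.
move=> sX sY; have -> : app L (app L (lie X Y)) x =
    L x *m (L x *m (jac Y x *m X x - jac X x *m Y x)) by [].
have -> : app L (fun y => lie X (app L Y) y + lie (app L X) Y y) x =
    L x *m (jac (app L Y) x *m X x - jac X x *m (L x *m Y x)
            + (jac Y x *m (L x *m X x) - jac (app L X) x *m Y x)) by [].
have -> : lie (app L X) (app L Y) x =
    jac (app L Y) x *m (L x *m X x) - jac (app L X) x *m (L x *m Y x) by [].
by rewrite !jac_app //; exact: torsion_identity.
Qed.

End Torsion.

Section Ne.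
Context (R : realType) (g2 k1 k2 : R[i]).
Hypothesis hk : k1 ^+ 2 + k2 ^+ 2 = 1.
Implicit Types (q : 'rV[R]_2) (x : 'rV[R]_(2 + 2)).

Definition mx2 (a b c d : R[i]) : 'M[R[i]]_2 :=
  \matrix_(i, j) if i == 0 then (if j == 0 then a else b)
                 else (if j == 0 then c else d).

Lemma mx2E (a b c d : R[i]) : (mx2 a b c d 0 0 = a) * (mx2 a b c d 0 1 = b) *
  (mx2 a b c d 1 0 = c) * (mx2 a b c d 1 1 = d).
Proof. by rewrite !mxE. Qed.

Definition ellA q : 'M[R[i]]_2 :=
  mx2 (g2 * crd q 0 ^+ 2 + k2 ^+ 2)      (g2 * k1 ^+ 2 * crd q 0 * crd q 1)
      (g2 * crd q 0 * crd q 1)           (g2 * k1 ^+ 2 * crd q 1 ^+ 2).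

(* The lower left entry of the cotangent lift:
   sum_k p_k (d A^k_1 / d q_2 - d A^k_2 / d q_1). *)
Definition ellc x : R[i] :=
  g2 * (crd (pos x) 0 * crd (mom x) 1 - k1 ^+ 2 * crd (pos x) 1 * crd (mom x) 0).

(** The two operators contribute k1 ^ 2 and k2 ^ 2 to the coefficient of g2 q1 ^ 2. These add up to
    1, so half the trace is - T and [N_e] is [K_e] plus T times the identity. *)
Lemma tr_K_e x : 2^-1 * \tr (K_e g2 k1 k2 x) = - ellT g2 k1 k2 (pos x).
Proof.
rewrite /mxtrace sum_ord4 !mxE /= /ellT.
have -> : k2 ^+ 2 = 1 - k1 ^+ 2 by rewrite -hk; ring.
by field.
Qed.

Lemma N_eE x : N_e g2 k1 k2 x =
  block_mx (ellA (pos x)) 0 (mx2 0 (ellc x) (- ellc x) 0) (ellA (pos x))^T.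
Proof.
have hk2 : k2 ^+ 2 = 1 - k1 ^+ 2 by rewrite -hk; ring.
rewrite /N_e tr_K_e; apply/matrixP => i j.
case: (ord4P i) => ->; case: (ord4P j) => ->;
  rewrite ?(block_mxEul, block_mxEur, block_mxEdl, block_mxEdr);
  rewrite !mxE /= /ellT /ellc ?hk2 ?mulr1n ?mulr0n; ring.
Qed.

Lemma K_eE x : K_e g2 k1 k2 x =
  N_e g2 k1 k2 x - (ellT g2 k1 k2 (pos x))%:M.
Proof. by rewrite /N_e tr_K_e raddfN opprK addrK. Qed.

Lemma tr_ellA q : ellA q 0 0 + ellA q 1 1 = ellT g2 k1 k2 q.
Proof. by rewrite !mx2E /ellT; ring. Qed.

Lemma det_ellA q : ellA q 0 0 * ellA q 1 1 - ellA q 0 1 * ellA q 1 0 =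
  ellP g2 k1 k2 q.
Proof. by rewrite !mx2E /ellP; ring. Qed.

(** [N_e] is block triangular with diagonal blocks A and its transpose, so its characteristic
    polynomial is the square of that of A, whose roots have sum T and product P. *)
Lemma eigenvalue_N_e x (a : R[i]) : eigenvalue (N_e g2 k1 k2 x) a <->
  a = lam1 g2 k1 k2 (pos x) \/ a = lam2 g2 k1 k2 (pos x).
Proof.
set A := ellA (pos x).
have detA : \det (A - a%:M) =
    (a - lam1 g2 k1 k2 (pos x)) * (a - lam2 g2 k1 k2 (pos x)).
  transitivity (a ^+ 2 - ellT g2 k1 k2 (pos x) * a + ellP g2 k1 k2 (pos x)).
    rewrite -tr_ellA -det_ellA det_mx2 -/A !(addmxE, oppmxE).
    have sE i j : (a%:M : 'M[R[i]]_2) i j = a *+ (i == j) by rewrite mxE.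
    by rewrite !sE /= !mulr1n !mulr0n; ring.
  by rewrite -lamD -lamM; ring.
have -> : eigenvalue (N_e g2 k1 k2 x) a = (\det (A - a%:M) == 0).
  rewrite /eigenvalue /eigenspace kermx_eq0 row_free_unit unitmxE unitfE negbK.
  rewrite N_eE (scalar_mx_block _ _ a) opp_block_mx add_block_mx oppr0 !addr0.
  rewrite det_lblock -/A -[a%:M in X in _ * X]tr_scalar_mx -linearB /= det_tr.
  by rewrite mulf_eq0 orbb.
rewrite detA mulf_eq0 !subr_eq0; split=> [/orP[] /eqP -> | [] ->]; rewrite ?eqxx ?orbT;
  by [left|right|].
Qed.

Definition dellA (j : 'I_2) q : 'M[R[i]]_2 :=
  if j == 0 then mx2 (2 * g2 * crd q 0) (g2 * k1 ^+ 2 * crd q 1) (g2 * crd q 1) 0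
  else mx2 0 (g2 * k1 ^+ 2 * crd q 0) (g2 * crd q 0) (2 * g2 * k1 ^+ 2 * crd q 1).

Lemma is_partial_ellA (j k l : 'I_2) q :
  is_partial j q (fun y => ellA y k l) (dellA j q k l).
Proof.
have c0 := is_partial_crd R j 0 q; have c1 := is_partial_crd R j 1 q.
case: (ord2P k) => ->; case: (ord2P l) => ->;
  under eq_fun do rewrite mx2E; (eapply is_partial_eq; first by partial_tac);
  by rewrite /dellA; case: (ord2P j) => -> /=; rewrite mx2E; ring.
Qed.

End Ne.

Section Nijenhuis.
Context (R : realType) (g2 k1 k2 : R[i]).
Hypothesis hk : k1 ^+ 2 + k2 ^+ 2 = 1.
Implicit Types (q : 'rV[R]_2) (x : 'rV[R]_(2 + 2)).
Local Notation A := (ellA R g2 k1 k2).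
Local Notation dA := (dellA R g2 k1).
Local Notation c := (ellc R g2 k1).
Local Notation N := (N_e g2 k1 k2).

Lemma crd_pos x i : crd (pos x) i = (x 0 (lshift 2 i))%:C.
Proof. by rewrite /crd /pos mxE. Qed.

Lemma crd_mom x i : crd (mom x) i = (x 0 (rshift 2 i))%:C.
Proof. by rewrite /crd /mom mxE. Qed.

Lemma is_partial_pos j i x :
  is_partial j x (fun y => crd (pos y) i) (lshift 2 i == j)%:R.
Proof.
under eq_fun do rewrite crd_pos.
by split; [exact: cdifferentiable_coord|exact: partial_coord].
Qed.

Lemma is_partial_mom j i x :
  is_partial j x (fun y => crd (mom y) i) (rshift 2 i == j)%:R.
Proof.
under eq_fun do rewrite crd_mom.
by split; [exact: cdifferentiable_coord|exact: partial_coord].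
Qed.

Lemma smooth_on_pos U i : smooth_on U (fun y : 'rV[R]_(2 + 2) => crd (pos y) i).
Proof. by under eq_fun do rewrite crd_pos; exact: smooth_on_coord. Qed.

Lemma smooth_on_mom U i : smooth_on U (fun y : 'rV[R]_(2 + 2) => crd (mom y) i).
Proof. by under eq_fun do rewrite crd_mom; exact: smooth_on_coord. Qed.

Definition dellc_pos (j : 'I_2) x : R[i] :=
  if j == 0 then g2 * crd (mom x) 1 else - (g2 * k1 ^+ 2 * crd (mom x) 0).

Definition dellc_mom (j : 'I_2) x : R[i] :=
  if j == 0 then - (g2 * k1 ^+ 2 * crd (pos x) 1) else g2 * crd (pos x) 0.

Lemma is_partial_ellc_pos (j : 'I_2) x :
  is_partial (lshift 2 j) x (fun y => c y) (dellc_pos j x).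
Proof.
have p0 := is_partial_pos (lshift 2 j) 0 x.
have p1 := is_partial_pos (lshift 2 j) 1 x.
have m0 := is_partial_mom (lshift 2 j) 0 x.
have m1 := is_partial_mom (lshift 2 j) 1 x.
eapply is_partial_eq; first by rewrite /ellc; partial_tac.
rewrite !eq_lshift !eq_rlshift /dellc_pos.
by case: (ord2P j) => -> /=; ring.
Qed.

Lemma is_partial_ellc_mom (j : 'I_2) x :
  is_partial (rshift 2 j) x (fun y => c y) (dellc_mom j x).
Proof.
have p0 := is_partial_pos (rshift 2 j) 0 x.
have p1 := is_partial_pos (rshift 2 j) 1 x.
have m0 := is_partial_mom (rshift 2 j) 0 x.
have m1 := is_partial_mom (rshift 2 j) 1 x.
eapply is_partial_eq; first by rewrite /ellc; partial_tac.
rewrite !eq_rshift !eq_lrshift /dellc_mom.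
by case: (ord2P j) => -> /=; ring.
Qed.

Lemma smooth_N_e i j : smooth_on setT (fun x => N x i j).
Proof.
have oT : open [set: 'rV[R]_(2 + 2)] by exact: openT.
have p0 := smooth_on_pos setT 0; have p1 := smooth_on_pos setT 1.
have m0 := smooth_on_mom setT 0; have m1 := smooth_on_mom setT 1.
have sA k l : smooth_on setT (fun x => A (pos x) k l).
  case: (ord2P k) => ->; case: (ord2P l) => ->;
    (eapply smooth_on_ext;
      [exact: oT | by move=> x _; rewrite mx2E; reflexivity | by smooth_tac]).
have sc : smooth_on setT c by rewrite /ellc; smooth_tac.
case: (split_ordP i) => {}i ->; case: (split_ordP j) => {}j ->.
- by apply: smooth_on_ext (sA i j) => // x _; rewrite N_eE // block_mxEul.
- apply: smooth_on_ext (smooth_on_cst _ _ _ 0) => // x _.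
  by rewrite N_eE // block_mxEur mxE.
- case: (ord2P i) => ->; case: (ord2P j) => ->.
  + apply: smooth_on_ext (smooth_on_cst _ _ _ 0) => // x _.
    by rewrite N_eE // block_mxEdl mx2E.
  + by apply: smooth_on_ext sc => // x _; rewrite N_eE // block_mxEdl mx2E.
  + apply: smooth_on_ext (smooth_onN _ _ _ _ oT sc) => // x _.
    by rewrite N_eE // block_mxEdl mx2E.
  + apply: smooth_on_ext (smooth_on_cst _ _ _ 0) => // x _.
    by rewrite N_eE // block_mxEdl mx2E.
- by apply: smooth_on_ext (sA j i) => // x _; rewrite N_eE // block_mxEdr [RHS]mxE.
Qed.

Lemma dtensor_N_e_pos (j : 'I_2) x : dtensor R N (lshift 2 j) x =
  block_mx (dA j (pos x)) 0 (mx2 R 0 (dellc_pos j x) (- dellc_pos j x) 0)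
           (dA j (pos x))^T.
Proof.
have dc := is_partial_ellc_pos j x.
have dAE k l : partial (lshift 2 j) (fun y => A (pos y) k l) x = dA j (pos x) k l.
  rewrite (partial_lsubmx_l _ _ _ j (fun q => A q k l)).
  by have [] := is_partial_ellA _ g2 k1 k2 j k l (pos x).
apply/matrixP => i m; rewrite [LHS]mxE.
case: (split_ordP i) => {}i ->; case: (split_ordP m) => {}m ->.
- by rewrite block_mxEul; under eq_fun do rewrite N_eE // block_mxEul; exact: dAE.
- rewrite block_mxEur; under eq_fun do rewrite N_eE // block_mxEur mxE.
  by rewrite partial_cst mxE.
- rewrite block_mxEdl; under eq_fun do rewrite N_eE // block_mxEdl.
  case: (ord2P i) => ->; case: (ord2P m) => ->; rewrite mx2E;
    under eq_fun do rewrite mx2E; rewrite ?partial_cst //; first by case: dc.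
  by have [] := is_partialN _ _ _ _ _ _ dc.
- rewrite block_mxEdr [RHS]mxE -dAE.
  have -> // : (fun y => N y (rshift 2 i) (rshift 2 m)) = fun y => A (pos y) m i.
  by apply/funext => y; rewrite N_eE // block_mxEdr [LHS]mxE.
Qed.

Lemma dtensor_N_e_mom (j : 'I_2) x : dtensor R N (rshift 2 j) x =
  block_mx 0 0 (mx2 R 0 (dellc_mom j x) (- dellc_mom j x) 0) 0.
Proof.
have dc := is_partial_ellc_mom j x.
have dAE k l : partial (rshift 2 j) (fun y => A (pos y) k l) x = 0.
  by rewrite (partial_lsubmx_r _ _ _ j (fun q => A q k l)).
apply/matrixP => i m; rewrite [LHS]mxE.
case: (split_ordP i) => {}i ->; case: (split_ordP m) => {}m ->.
- by rewrite block_mxEul; under eq_fun do rewrite N_eE // block_mxEul; rewrite dAE mxE.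
- rewrite block_mxEur; under eq_fun do rewrite N_eE // block_mxEur mxE.
  by rewrite partial_cst mxE.
- rewrite block_mxEdl; under eq_fun do rewrite N_eE // block_mxEdl.
  case: (ord2P i) => ->; case: (ord2P m) => ->; rewrite mx2E;
    under eq_fun do rewrite mx2E; rewrite ?partial_cst //; first by case: dc.
  by have [] := is_partialN _ _ _ _ _ _ dc.
- rewrite block_mxEdr [RHS]mxE -(dAE m i).
  have -> // : (fun y => N y (rshift 2 i) (rshift 2 m)) = fun y => A (pos y) m i.
  by apply/funext => y; rewrite N_eE // block_mxEdr [LHS]mxE.
Qed.

(** Matrices and vectors become functions of natural numbers here: at concrete indices the torsion
    then computes to an explicit polynomial that [ring] can decide. The bracketing is that of
    [sum_ord4]. *)
Definition mulf (M : nat -> nat -> R[i]) (v : nat -> R[i]) (i : nat) : R[i] :=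
  M i 0%N * v 0%N + M i 1%N * v 1%N + (M i 2%N * v 2%N + M i 3%N * v 3%N).

Definition torsionf (L : nat -> nat -> R[i]) (D : nat -> nat -> nat -> R[i])
    (X Y : nat -> R[i]) (i : nat) : R[i] :=
  let DX Z k l := mulf (D l) Z k in
  mulf (DX Y) (mulf L X) i - mulf (DX X) (mulf L Y) i
  - mulf L (mulf (DX Y) X) i + mulf L (mulf (DX X) Y) i.

Lemma torsionfE (L : tensor11 R) x (X Y : vfield R)
    (Lf : nat -> nat -> R[i]) (Df : nat -> nat -> nat -> R[i]) (Xf Yf : nat -> R[i]) :
  (forall i j : 'I_(2 + 2), L x i j = Lf i j) ->
  (forall l i j : 'I_(2 + 2), dtensor R L l x i j = Df l i j) ->
  (forall i : 'I_(2 + 2), X x i 0 = Xf i) ->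
  (forall i : 'I_(2 + 2), Y x i 0 = Yf i) ->
  forall i : 'I_(2 + 2),
  (dtensor_app _ L Y x *m (L x *m X x) - dtensor_app _ L X x *m (L x *m Y x)
   - L x *m (dtensor_app _ L Y x *m X x) + L x *m (dtensor_app _ L X x *m Y x)) i 0 =
  torsionf Lf Df Xf Yf i.
Proof.
move=> LE DE XE YE i.
have mE (M : 'M[R[i]]_(2 + 2)) (v : 'cV[R[i]]_(2 + 2))
    (Mf : nat -> nat -> R[i]) (vf : nat -> R[i]) k :
    (forall i j : 'I_(2 + 2), M i j = Mf i j) ->
    (forall i : 'I_(2 + 2), v i 0 = vf i) -> (M *m v) k 0 = mulf Mf vf k.
  by move=> ME vE; rewrite mxE sum_ord4 !ME !vE.
have dtE (Z : vfield R) (Zf : nat -> R[i]) k l :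
    (forall i : 'I_(2 + 2), Z x i 0 = Zf i) ->
    dtensor_app _ L Z x k l = mulf (Df l) Zf k.
  by move=> ZE; rewrite mxE; apply: (mE) => // *; exact: DE.
rewrite !(addmxE, oppmxE); congr (_ - _ - _ + _).
- by apply: (mE) => [k l|k]; [exact: dtE|exact: mE].
- by apply: (mE) => [k l|k]; [exact: dtE|exact: mE].
- by apply: (mE) => // k; apply: (mE) => // l m; exact: dtE.
- by apply: (mE) => // k; apply: (mE) => // l m; exact: dtE.
Qed.

Definition entry (rows : seq (seq R[i])) (i j : nat) : R[i] :=
  nth 0 (nth [::] rows i) j.

Definition N_e_table x : seq (seq R[i]) :=
  let A k l := A (pos x) k l in
  [:: [:: A 0 0;  A 0 1;  0;     0];
      [:: A 1 0;  A 1 1;  0;     0];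
      [:: 0;      c x;    A 0 0; A 1 0];
      [:: - c x;  0;      A 0 1; A 1 1]].

Definition dN_e_pos_table (j : 'I_2) x : seq (seq R[i]) :=
  let A k l := dA j (pos x) k l in
  [:: [:: A 0 0;            A 0 1;          0;     0];
      [:: A 1 0;            A 1 1;          0;     0];
      [:: 0;                dellc_pos j x;  A 0 0; A 1 0];
      [:: - dellc_pos j x;  0;              A 0 1; A 1 1]].

Definition dN_e_mom_table (j : 'I_2) x : seq (seq R[i]) :=
  [:: [:: 0;                0;              0;     0];
      [:: 0;                0;              0;     0];
      [:: 0;                dellc_mom j x;  0;     0];
      [:: - dellc_mom j x;  0;              0;     0]].

Lemma block_table (A B C D : 'M[R[i]]_2) (i j : 'I_(2 + 2)) :
  block_mx A B C D i j = entry
    [:: [:: A 0 0; A 0 1; B 0 0; B 0 1];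
        [:: A 1 0; A 1 1; B 1 0; B 1 1];
        [:: C 0 0; C 0 1; D 0 0; D 0 1];
        [:: C 1 0; C 1 1; D 1 0; D 1 1]] i j.
Proof.
by case: (ord4P i) => ->; case: (ord4P j) => ->;
  rewrite ?(block_mxEul, block_mxEur, block_mxEdl, block_mxEdr).
Qed.

Lemma mx2T (M : 'M[R[i]]_2) i j : M^T i j = M j i.
Proof. by rewrite mxE. Qed.

Lemma mx20 i j : (0 : 'M[R[i]]_2) i j = 0.
Proof. by rewrite mxE. Qed.

Lemma Nijenhuis_N_e : Nijenhuis_operator N.
Proof.
split; first exact: smooth_N_e.
move=> X Y sX sY x; rewrite (torsionE _ _ smooth_N_e) //.
pose Df (l : nat) := nth (fun _ _ => 0)
  [:: entry (dN_e_pos_table 0 x); entry (dN_e_pos_table 1 x);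
      entry (dN_e_mom_table 0 x); entry (dN_e_mom_table 1 x)] l.
have LE i j : N x i j = entry (N_e_table x) i j.
  by rewrite N_eE // block_table /N_e_table !mx2T !mx2E !mx20.
have DE l i j : dtensor R N l x i j = Df l i j.
  by case: (ord4P l) => ->; rewrite ?dtensor_N_e_pos ?dtensor_N_e_mom
    block_table /Df /= /dN_e_pos_table /dN_e_mom_table ?mx2T !mx2E ?mx20.
(* [inord] extends the components to all natural numbers. It wants an index type in successor form,
   hence [3.+1] for [2 + 2]. *)
have vE (Z : vfield R) (i : 'I_(2 + 2)) : Z x i 0 = Z x (inord i : 'I_(3.+1)) 0.
  by rewrite inord_val.
apply/matrixP => i j; rewrite (ord1 j) [RHS]mxE.
pose vf (Z : vfield R) (m : nat) := Z x (inord m : 'I_(3.+1)) 0.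
rewrite (torsionfE _ _ _ _ _ _ (vf X) (vf Y) LE DE (vE X) (vE Y)).
(* By tensoriality only the values at [x] remain, and they may be arbitrary. *)
move: (vf X) (vf Y) => Xf Yf.
by case: i => -[|[|[|[|//]]]] ilt; rewrite /torsionf /mulf /Df /entry /=;
  rewrite /dA /= !mx2E /ellc /dellc_pos /dellc_mom /=; ring.
Qed.

End Nijenhuis.

(** * The eigencovector equation and its derivative *)

Section Recursion.
Context (R : realType) (g2 k1 k2 : R[i]).
Implicit Types (q : 'rV[R]_2) (i j k l : 'I_2).
Local Notation A := (ellA R g2 k1 k2).
Local Notation J := (Jmx g2 k1 k2).

(** Underlying are dT A = T dT - dP and dP A = P dT. Hence (l dT - dP) A = (l T - P) dT - l dP, and
    l T - P = l ^ 2 makes this l (l dT - dP). *)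
Lemma J_ellA i l q : off_focal g2 k1 k2 q ->
  J q i 0 * A q 0 l + J q i 1 * A q 1 l = lam g2 k1 k2 q i 0 * J q i l.
Proof.
move=> Uq; apply: (mulfI (lamR_neq0 _ _ _ _ i q Uq)).
rewrite mulrDr !mulrA [_ * lam _ _ _ _ _ _]mulrC -[RHS]mulrA !J_lam //.
rewrite !mulrBr !mulrA -expr2 lam_root.
case: (ord2P l) => ->; rewrite !mx2E /ellT /ellP /dellT /dellP /=; ring.
Qed.

Lemma hess_ellA i j l q : off_focal g2 k1 k2 q ->
  hess _ g2 k1 k2 i q j 0 * A q 0 l + hess _ g2 k1 k2 i q j 1 * A q 1 l
  + (J q i 0 * dellA _ g2 k1 j q 0 l + J q i 1 * dellA _ g2 k1 j q 1 l) =
  J q i j * J q i l + lam g2 k1 k2 q i 0 * hess _ g2 k1 k2 i q j l.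
Proof.
move=> Uq; have dl := is_partial_lam _ _ _ _ i j q Uq.
have dJ k := is_partial_J _ _ _ _ i j k q Uq.
have J0 := dJ 0; have J1 := dJ 1; have Jl := dJ l.
have A0 := is_partial_ellA _ g2 k1 k2 j 0 l q.
have A1 := is_partial_ellA _ g2 k1 k2 j 1 l q.
have [_ e1] : is_partial j q
  (fun y => J y i 0 * A y 0 l + J y i 1 * A y 1 l)
  (hess _ g2 k1 k2 i q j 0 * A q 0 l + J q i 0 * dellA _ g2 k1 j q 0 l
  + (hess _ g2 k1 k2 i q j 1 * A q 1 l + J q i 1 * dellA _ g2 k1 j q 1 l)).
  by partial_tac.
have [_ e2] : is_partial j q (fun y => lam g2 k1 k2 y i 0 * J y i l)
  (J q i j * J q i l + lam g2 k1 k2 q i 0 * hess _ g2 k1 k2 i q j l).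
  by partial_tac.
have := partial_ext_on _ _ _ j _ _ _ (open_off_focal _ _ _ _)
  (fun y => J_ellA i l y) Uq.
by rewrite e1 e2 => <-; ring.
Qed.

End Recursion.

(** * The extended point transformation *)

Lemma eq_block_mx (T : Type) m1 m2 n1 n2 (A A' : 'M[T]_(m1, n1))
    (B B' : 'M[T]_(m1, n2)) (C C' : 'M[T]_(m2, n1)) (D D' : 'M[T]_(m2, n2)) :
  A = A' -> B = B' -> C = C' -> D = D' -> block_mx A B C D = block_mx A' B' C' D'.
Proof. by move=> -> -> -> ->. Qed.

(** For a block lower triangular matrix the symplectic condition splits: symmetry of [J^T *m B]
    removes the dq /\ dq part, and [J^T *m V = 1%:M] gives the mixed part. *)
Lemma symplectic_block (R : realType) (J B V : 'M[R[i]]_2) :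
  (J^T *m B)^T = J^T *m B -> J^T *m V = 1%:M ->
  (block_mx J 0 B V)^T *m Omega R *m block_mx J 0 B V = Omega R.
Proof.
move=> sB JV.
have BJ : B^T *m J = J^T *m B by rewrite -sB trmx_mul trmxK.
have VJ : V^T *m J = 1%:M by rewrite -[LHS]trmxK trmx_mul trmxK JV trmx1.
have -> : (block_mx J 0 B V)^T = block_mx J^T B^T 0 V^T.
  by rewrite tr_block_mx trmx0.
have OJ : Omega R *m block_mx J 0 B V = block_mx B V (- J) 0.
  rewrite /Omega mulmx_block; apply: eq_block_mx.
  - by rewrite mul0mx mul1mx add0r.
  - by rewrite mul0mx mul1mx add0r.
  - by rewrite mulNmx mul1mx mul0mx addr0.
  - by rewrite mulmx0 mul0mx addr0.
rewrite -mulmxA OJ mulmx_block /Omega; apply: eq_block_mx.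
- by rewrite mulmxN BJ addrN.
- by rewrite JV mulmx0 addr0.
- by rewrite mul0mx add0r mulmxN VJ.
- by rewrite mul0mx mulmx0 addr0.
Qed.

Section lift_block.
Context (R : comUnitRingType) (n : nat) (J JT B V A AT L S C : 'M[R]_n).
Hypotheses (uJ : JT \in unitmx) (JV : JT *m V = 1%:M) (AJ : AT *m JT = JT *m L).

Lemma lift_block_diag : V *m AT = L *m V.
Proof.
by apply: (can_inj (mulKmx uJ)); rewrite !mulmxA JV mul1mx -AJ -mulmxA JV mulmx1.
Qed.

(** Invertibility of [JT] allows the equation to be checked after multiplication by it, where [V]
    turns into the identity and [B] into [- S]. *)
Lemma lift_block_lower : JT *m B = - S -> C + AT *m S = S *m A ->
  B *m A + V *m C = L *m B.
Proof.
move=> JB CS; apply: (can_inj (mulKmx uJ)).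
rewrite mulmxDr mulmxA JB (mulmxA JT V) JV mul1mx (mulmxA JT L) -AJ -mulmxA JB.
by rewrite mulNmx mulmxN -CS opprD addrC addrA addrN add0r.
Qed.

Lemma lift_block : J *m A = L *m J -> JT *m B = - S -> C + AT *m S = S *m A ->
  block_mx J 0 B V *m block_mx A 0 C AT = block_mx L 0 0 L *m block_mx J 0 B V.
Proof.
move=> JA JB CS; rewrite !mulmx_block; apply: eq_block_mx.
- by rewrite !mul0mx !addr0.
- by rewrite !mul0mx !mulmx0.
- by rewrite mul0mx add0r; exact: lift_block_lower.
- by rewrite !mulmx0 !add0r; exact: lift_block_diag.
Qed.

End lift_block.

(** * The lifted map over an open set on which J is invertible *)

Section Darboux.
Context (R : realType) (g2 k1 k2 : R[i]).
Hypothesis hk : k1 ^+ 2 + k2 ^+ 2 = 1.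
Context (U : set 'rV[R]_2).
Hypotheses (oU : open U) (UF : U `<=` off_focal g2 k1 k2)
  (UJ : forall q, U q -> Jmx g2 k1 k2 q \in unitmx).
Implicit Types (q : 'rV[R]_2) (x : 'rV[R]_(2 + 2)) (i j k l : 'I_2).
Local Notation A := (ellA R g2 k1 k2).
Local Notation J := (Jmx g2 k1 k2).
Local Notation H := (hess R g2 k1 k2).
Local Notation Phi := (ell_map g2 k1 k2).
Local Notation W := [set x : 'rV[R]_(2 + 2) | U (pos x)].
Local Notation Pm := (fun x => newP g2 k1 k2 (pos x) (mom x)).

Lemma open_W : open W.
Proof. exact: open_lsubmx. Qed.

Lemma smooth_newP i : smooth_on W (fun x => Pm x i 0).
Proof.
have oW := open_W.
have sJ k : smooth_on W (fun x => invmx (J (pos x)) k i).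
  apply: (smooth_on_lsubmx R 2 2 U (fun q => invmx (J q) k i)).
  apply: smooth_on_invmx => // a b.
  exact: smooth_on_sub UF (smooth_J R g2 k1 k2 a b).
apply: (smooth_on_ext _ _ _
  (fun x => \sum_k invmx (J (pos x)) k i * crd (mom x) k)) => //.
  by move=> x Wx; rewrite /newP mxE; apply: eq_bigr => k _; rewrite !mxE.
by apply: smooth_on_sum => // k _; apply: smooth_onM => //; exact: smooth_on_mom.
Qed.

Lemma newPK q p : U q -> (J q)^T *m newP g2 k1 k2 q p = colC p.
Proof.
by move=> /UJ uJ; rewrite /newP mulmxA -trmx_mul mulVmx // trmx1 mul1mx.
Qed.

Lemma newP_crd k x : U (pos x) ->
  J (pos x) 0 k * Pm x 0 0 + J (pos x) 1 k * Pm x 1 0 = crd (mom x) k.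
Proof.
move=> Ux; have /matrixP/(_ k 0) := newPK (pos x) (mom x) Ux.
rewrite [in LHS]mxE sum_ord2 [in RHS]mxE => <-.
by rewrite ![_^T _ _]mxE.
Qed.

Definition dP_pos x : 'M[R[i]]_2 :=
  \matrix_(i, j) partial (lshift 2 j) (fun y => Pm y i 0) x.
Definition dP_mom x : 'M[R[i]]_2 :=
  \matrix_(i, j) partial (rshift 2 j) (fun y => Pm y i 0) x.
(** The sum of P_i Hess(lambda_i), indexed as it appears when equation [k] of J^T P = p is
    differentiated along q_j. *)
Definition hessP x : 'M[R[i]]_2 :=
  \matrix_(k, j) (H 0 (pos x) j k * Pm x 0 0 + H 1 (pos x) j k * Pm x 1 0).

Lemma hessP_sym x : U (pos x) -> (hessP x)^T = hessP x.
Proof.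
move=> Ux; have Fx := UF _ Ux; apply/matrixP => k j; rewrite mxE [LHS]mxE [RHS]mxE.
by rewrite !(hess_sym _ _ _ _ _ j k).
Qed.

Lemma is_partial_newP_pos i j x : U (pos x) ->
  is_partial (lshift 2 j) x (fun y => Pm y i 0) (dP_pos x i j).
Proof.
move=> Ux; rewrite mxE; apply: is_partial_self.
exact: smooth_on_cdifferentiable (smooth_newP i) Ux.
Qed.

Lemma is_partial_newP_mom i j x : U (pos x) ->
  is_partial (rshift 2 j) x (fun y => Pm y i 0) (dP_mom x i j).
Proof.
move=> Ux; rewrite mxE; apply: is_partial_self.
exact: smooth_on_cdifferentiable (smooth_newP i) Ux.
Qed.

Lemma smooth_J_pos i k : smooth_on W (fun y => J (pos y) i k).
Proof.
apply: (smooth_on_lsubmx R 2 2 U (fun q => J q i k)).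
exact: smooth_on_sub UF (smooth_J R g2 k1 k2 i k).
Qed.

Lemma is_partial_J_pos i k j x : U (pos x) ->
  is_partial (lshift 2 j) x (fun y => J (pos y) i k) (H i (pos x) j k).
Proof.
move=> Ux; split.
  exact: smooth_on_cdifferentiable (smooth_J_pos i k) Ux.
rewrite (partial_lsubmx_l _ _ _ j (fun q => J q i k)).
by have [] := is_partial_J _ g2 k1 k2 i j k (pos x) (UF _ Ux).
Qed.

Lemma is_partial_J_mom i k j x : U (pos x) ->
  is_partial (rshift 2 j) x (fun y => J (pos y) i k) 0.
Proof.
move=> Ux; split.
  exact: smooth_on_cdifferentiable (smooth_J_pos i k) Ux.
by rewrite (partial_lsubmx_r _ _ _ j (fun q => J q i k)).
Qed.

Lemma J_dP_pos x : U (pos x) -> (J (pos x))^T *m dP_pos x = - hessP x.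
Proof.
move=> Ux; apply/matrixP => k j.
have [J0 J1] := (is_partial_J_pos 0 k j x Ux, is_partial_J_pos 1 k j x Ux).
have [P0 P1] := (is_partial_newP_pos 0 j x Ux, is_partial_newP_pos 1 j x Ux).
have [_ e] : is_partial (lshift 2 j) x
    (fun y => J (pos y) 0 k * Pm y 0 0 + J (pos y) 1 k * Pm y 1 0)
    (H 0 (pos x) j k * Pm x 0 0 + J (pos x) 0 k * dP_pos x 0 j
     + (H 1 (pos x) j k * Pm x 1 0 + J (pos x) 1 k * dP_pos x 1 j)).
  by partial_tac.
have := partial_ext_on _ _ _ (lshift 2 j) _ _ _ open_W (newP_crd k) Ux.
have [_ ->] := is_partial_mom R (lshift 2 j) k x.
rewrite e eq_rlshift => e0.
rewrite [LHS]mxE sum_ord2 !mx2T oppmxE [hessP _ _ _]mxE.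
by apply/eqP; rewrite -addr_eq0 -[X in _ == X]e0; apply/eqP; ring.
Qed.

Lemma J_dP_mom x : U (pos x) -> (J (pos x))^T *m dP_mom x = 1%:M.
Proof.
move=> Ux; apply/matrixP => k j.
have [J0 J1] := (is_partial_J_mom 0 k j x Ux, is_partial_J_mom 1 k j x Ux).
have [P0 P1] := (is_partial_newP_mom 0 j x Ux, is_partial_newP_mom 1 j x Ux).
have [_ e] : is_partial (rshift 2 j) x
    (fun y => J (pos y) 0 k * Pm y 0 0 + J (pos y) 1 k * Pm y 1 0)
    (0 * Pm x 0 0 + J (pos x) 0 k * dP_mom x 0 j
     + (0 * Pm x 1 0 + J (pos x) 1 k * dP_mom x 1 j)).
  by partial_tac.
have := partial_ext_on _ _ _ (rshift 2 j) _ _ _ open_W (newP_crd k) Ux.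
have [_ ->] := is_partial_mom R (rshift 2 j) k x.
rewrite e eq_rshift => e0.
by rewrite [LHS]mxE sum_ord2 !mx2T [RHS]mxE -e0; ring.
Qed.

Lemma jac_ell_map x : U (pos x) ->
  jac Phi x = block_mx (J (pos x)) 0 (dP_pos x) (dP_mom x).
Proof.
move=> Ux; apply/matrixP => i j; rewrite [LHS]mxE.
have uE k y : Phi y (lshift 2 k) 0 = lam g2 k1 k2 (pos y) k 0.
  by rewrite /ell_map col_mxEu.
have dE k y : Phi y (rshift 2 k) 0 = Pm y k 0 by rewrite /ell_map col_mxEd.
case: (split_ordP i) => {}i ->; case: (split_ordP j) => {}j ->.
- under eq_fun do rewrite uE; rewrite block_mxEul.
  rewrite (partial_lsubmx_l _ _ _ j (fun q => lam g2 k1 k2 q i 0)).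
  by rewrite [RHS]mxE.
- under eq_fun do rewrite uE; rewrite block_mxEur mx20.
  by rewrite (partial_lsubmx_r _ _ _ j (fun q => lam g2 k1 k2 q i 0)).
- by under eq_fun do rewrite dE; rewrite block_mxEdl [RHS]mxE.
- by under eq_fun do rewrite dE; rewrite block_mxEdr [RHS]mxE.
Qed.

Lemma jac_ell_map_unit x : U (pos x) -> jac Phi x \in unitmx.
Proof.
move=> Ux; rewrite jac_ell_map // unitmxE det_lblock unitrM -!unitmxE UJ //=.
by have /mulmx1_unit[] := J_dP_mom x Ux.
Qed.

Lemma canonical_ell_map : canonical_on W Phi.
Proof.
move=> x Ux; rewrite jac_ell_map //; apply: symplectic_block.
  by rewrite J_dP_pos // linearN /= hessP_sym.
exact: J_dP_mom.
Qed.

Definition Lam q : 'M[R[i]]_2 := diag_mx (lam g2 k1 k2 q)^T.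

Lemma LamE q i (M : 'M[R[i]]_2) j : (Lam q *m M) i j = lam g2 k1 k2 q i 0 * M i j.
Proof. by rewrite mul_diag_mx mxE [_^T _ _]mxE. Qed.

Lemma J_ellA_mx q : U q -> J q *m A q = Lam q *m J q.
Proof.
move=> Uq; apply/matrixP => i l; rewrite LamE -(J_ellA _ _ _ _ i l) //.
  by rewrite mxE sum_ord2.
exact: UF.
Qed.

Lemma ellA_J_mx q : U q -> (A q)^T *m (J q)^T = (J q)^T *m Lam q.
Proof. by move=> Uq; rewrite -trmx_mul J_ellA_mx // trmx_mul /Lam tr_diag_mx. Qed.

(* Antisymmetrize the derivative of J A = Lambda J, contracted with P. *)
Lemma hessP_ellA x : U (pos x) ->
  mx2 R 0 (ellc R g2 k1 x) (- ellc R g2 k1 x) 0 + (A (pos x))^T *m hessP x =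
  hessP x *m A (pos x).
Proof.
move=> Ux; have Fx := UF _ Ux.
have h i j l := hess_ellA R g2 k1 k2 i j l (pos x) Fx.
(* [hess_ellA] trades the product of Hessian and A for terms symmetric in [j] and [l], minus J
   contracted with the derivative of A; summed against P, J becomes p by [newP_crd]. *)
have hP j l : (hessP x *m A (pos x)) j l =
    Pm x 0 0 * (J (pos x) 0 j * J (pos x) 0 l + lam g2 k1 k2 (pos x) 0 0 * H 0 (pos x) j l)
  + Pm x 1 0 * (J (pos x) 1 j * J (pos x) 1 l + lam g2 k1 k2 (pos x) 1 0 * H 1 (pos x) j l)
  - (crd (mom x) 0 * dellA R g2 k1 j (pos x) 0 l
     + crd (mom x) 1 * dellA R g2 k1 j (pos x) 1 l).
  have hE k : hessP x j k = H 0 (pos x) j k * Pm x 0 0 + H 1 (pos x) j k * Pm x 1 0.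
    by rewrite -[hessP x]hessP_sym // mx2T mxE.
  rewrite mxE sum_ord2 -!h -!newP_crd // !hE.
  by ring.
(* Since [hessP] is symmetric, A^T S is the transpose of S A. The claim thus concerns the
   antisymmetric part of S A alone, where only the p-terms survive. *)
have hT j l : ((A (pos x))^T *m hessP x) j l = (hessP x *m A (pos x)) l j.
  by rewrite -[in LHS](hessP_sym x Ux) -trmx_mul mx2T.
apply/matrixP => j l; rewrite addmxE hT !hP.
have hs i := hess_sym R g2 k1 k2 i 0 1 (pos x) Fx.
move: (H 0 (pos x)) (H 1 (pos x)) (hs 0) (hs 1) => H0 H1 h0 h1.
move: (J (pos x)) (newP g2 k1 k2 (pos x) (mom x)) (lam g2 k1 k2 (pos x)) => M P v.
rewrite /ellc /dellA; case: (ord2P j) => ->; case: (ord2P l) => ->;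
  by rewrite /= !mx2E ?h0 ?h1; ring.
Qed.

Lemma jac_ell_map_N_e x : U (pos x) ->
  jac Phi x *m N_e g2 k1 k2 x =
  block_mx (Lam (pos x)) 0 0 (Lam (pos x)) *m jac Phi x.
Proof.
move=> Ux; rewrite jac_ell_map // N_eE //.
have uJ : (J (pos x))^T \in unitmx by rewrite unitmx_tr UJ.
exact: (lift_block _ _ _ _ _ _ _ _ _ _ _ uJ (J_dP_mom x Ux) (ellA_J_mx _ Ux)
  (J_ellA_mx _ Ux) (J_dP_pos x Ux) (hessP_ellA x Ux)).
Qed.

(** [K_e] and [N_e] differ by a multiple of the identity at each point, and conjugation leaves that
    multiple alone. *)
Lemma diag_ell_map x : U (pos x) ->
  is_diag_mx (jac Phi x *m K_e g2 k1 k2 x *m invmx (jac Phi x)).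
Proof.
move=> Ux; have uJ := jac_ell_map_unit x Ux.
rewrite K_eE // mulmxBr mulmxBl jac_ell_map_N_e // mulmxK //.
rewrite scalar_mxC mulmxK //.
apply/is_diag_mxP => i j ij.
have ij' : i != j by apply: contraNneq ij => ->.
rewrite addmxE oppmxE [_%:M _ _]mxE (negPf ij') mulr0n subr0.
move: ij'; case: (split_ordP i) => {ij}i ->; case: (split_ordP j) => {}j ->.
- by rewrite block_mxEul eq_lshift => ij; rewrite mxE (negPf ij).
- by rewrite block_mxEur mx20.
- by rewrite block_mxEdl mx20.
- by rewrite block_mxEdr eq_rshift => ij; rewrite mxE (negPf ij).
Qed.

Hypothesis lam_inj : {in U &, injective (lam g2 k1 k2)}.

Lemma colC_inj : injective (@colC R).
Proof.
move=> u v uv; apply/rowP => j; have /matrixP/(_ j 0) := uv.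
by rewrite !mxE => -[].
Qed.

(** The new positions return q by assumption; the old momenta are then J(q)^T P. *)
Lemma ell_map_inj : {in W &, injective Phi}.
Proof.
move=> x y /set_mem Wx /set_mem Wy /eq_col_mx[exy pxy].
have qxy : pos x = pos y by apply: lam_inj => //; exact: mem_set.
suff pm : mom x = mom y.
  by rewrite -[x]hsubmxK -[y]hsubmxK; congr row_mx.
apply: colC_inj; rewrite -(newPK _ (mom x) Wx) pxy qxy newPK //.
Qed.

Lemma smooth_ell_map (i : 'I_(2 + 2)) : smooth_on W (fun x => Phi x i 0).
Proof.
case: (split_ordP i) => {}i ->.
  apply: (smooth_on_ext _ _ _ (fun x => lam g2 k1 k2 (pos x) i 0)).
  - exact: open_W.
  - by move=> x _; rewrite col_mxEu.
  apply: (smooth_on_lsubmx R 2 2 U (fun q => lam g2 k1 k2 q i 0)).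
  exact: smooth_on_sub UF (smooth_lam R g2 k1 k2 i).
apply: (smooth_on_ext _ _ _ (fun x => Pm x i 0)).
- exact: open_W.
- by move=> x _; rewrite col_mxEd.
exact: smooth_newP.
Qed.

Lemma Darboux_Haantjes_ell_map : Darboux_Haantjes W (K_e g2 k1 k2) Phi.
Proof.
split; [split|exact: canonical_ell_map|exact: diag_ell_map].
- exact: open_W.
- exact: smooth_ell_map.
- exact: ell_map_inj.
- exact: jac_ell_map_unit.
Qed.

Lemma extended_point_transformation_ell_map :
  extended_point_transformation W Phi.
Proof.
split; first exact: canonical_ell_map.
have uE x : usubmx (Phi x) = lam g2 k1 k2 (pos x) by exact: col_mxKu.
by move=> x y _ _ xy; rewrite !uE xy.
Qed.

End Darboux.

(** * Discriminant, generating function and Staeckel form *)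

Section Discriminant.
Context (R : realType) (g2 k1 k2 : R[i]).
Implicit Types (q : 'rV[R]_2).

Lemma crd_real q j : crd q j \is Num.real.
Proof. by rewrite /crd complex_real. Qed.

Lemma crd_eq0 q j : (crd q j == 0) = (q 0 j == 0).
Proof. by rewrite /crd eq_complex /= eqxx andbT. Qed.

Lemma real_Im0 (z : R[i]) : complex.Im z = 0 -> z \is Num.real.
Proof. by case: z => a b /= ->; rewrite complex_real. Qed.

(** With s the root of g2, P is the square of s k1 k2 q2, so the discriminant is a difference of
    squares; completing the square in T + 2 s k1 k2 q2 and T - 2 s k1 k2 q2 gives the two
    factors. *)
Lemma discr_factor q : discr g2 k1 k2 q =
  (g2 * crd q 0 ^+ 2 + (sqrtc g2 * k1 * crd q 1 + k2) ^+ 2) *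
  (g2 * crd q 0 ^+ 2 + (sqrtc g2 * k1 * crd q 1 - k2) ^+ 2).
Proof.
rewrite /discr /ellT /ellP; move: (sqr_sqrtc g2); set s := sqrtc g2 => <-.
by ring.
Qed.

Hypotheses (rk1 : k1 \is Num.real) (rk2 : k2 \is Num.real).

Lemma sqr_real_ge0 (z : R[i]) : z \is Num.real -> 0 <= z ^+ 2.
Proof. by move=> rz; rewrite real_exprn_even_ge0. Qed.

Lemma ellT_real q : g2 \is Num.real -> ellT g2 k1 k2 q \is Num.real.
Proof.
move=> rg; have r j := crd_real q j.
apply: realD; last exact: realX.
apply: realM => //; apply: realD; first exact: realX.
by apply: realM; exact: realX.
Qed.

Lemma discr_ge0 q : g2 \is Num.real -> 0 <= discr g2 k1 k2 q.
Proof.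
move=> rg; have [r0 r1] := (crd_real q 0, crd_real q 1).
have [s0 s1] := (sqr_real_ge0 _ r0, sqr_real_ge0 _ r1).
case/orP: (rg) => g0.
  rewrite discr_factor; have rs : sqrtc g2 \is Num.real by rewrite ger0_real // sqrtc_ge0.
  have rm : sqrtc g2 * k1 * crd q 1 \is Num.real by rewrite !realM.
  have gq : 0 <= g2 * crd q 0 ^+ 2 by exact: mulr_ge0.
  apply: mulr_ge0; apply: addr_ge0 => //; apply: sqr_real_ge0; first exact: realD.
  exact: realB.
(* For g2 <= 0 the root of g2 is no longer a positive real, but P <= 0, so the discriminant is at
   least T ^ 2. *)
have rT := ellT_real q rg.
rewrite /discr subr_ge0 (le_trans _ (sqr_real_ge0 _ rT)) // pmulr_rle0 //.
have [z1 z2] := (sqr_real_ge0 _ rk1, sqr_real_ge0 _ rk2).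
have -> : ellP g2 k1 k2 q = g2 * (k1 ^+ 2 * (k2 ^+ 2 * crd q 1 ^+ 2)).
  by rewrite /ellP; ring.
by apply: mulr_le0_ge0 => //; apply: mulr_ge0 => //; exact: mulr_ge0.
Qed.

Lemma discr_eq0 q : 0 < g2 -> k1 != 0 -> discr g2 k1 k2 q = 0 <->
  crd q 0 = 0 /\ (crd q 1 = k2 / (sqrtc g2 * k1) \/
                  crd q 1 = - (k2 / (sqrtc g2 * k1))).
Proof.
move=> g0 k10; have s0 : sqrtc g2 != 0 by rewrite sqrtc_eq0 gt_eqF.
have rs : sqrtc g2 \is Num.real by rewrite ger0_real // sqrtc_ge0 ltW.
have [r0 r1] := (crd_real q 0, crd_real q 1).
have rm : sqrtc g2 * k1 * crd q 1 \is Num.real by rewrite !realM.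
(* For g2 > 0 each factor is a sum of two nonnegative reals and vanishes only if both do. *)
have fac (z : R[i]) : z \is Num.real ->
    (g2 * crd q 0 ^+ 2 + z ^+ 2 == 0) = (crd q 0 == 0) && (z == 0).
  move=> rz; have gq : 0 <= g2 * crd q 0 ^+ 2.
    by apply: mulr_ge0; [exact: ltW|exact: sqr_real_ge0].
  rewrite (paddr_eq0 gq (sqr_real_ge0 _ rz)).
  by rewrite mulf_eq0 !sqrf_eq0 (gt_eqF g0).
have e1 : (sqrtc g2 * k1 * crd q 1 + k2 == 0) =
          (crd q 1 == - (k2 / (sqrtc g2 * k1))).
  rewrite -mulNr; apply/eqP/eqP => [/eqP|->]; last by field; rewrite ?s0 ?k10.
  by rewrite addr_eq0 => /eqP <-; field; rewrite ?s0 ?k10.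
have e2 : (sqrtc g2 * k1 * crd q 1 - k2 == 0) =
          (crd q 1 == k2 / (sqrtc g2 * k1)).
  apply/eqP/eqP => [/eqP|->]; last by field; rewrite ?s0 ?k10.
  by rewrite subr_eq0 => /eqP <-; field; rewrite ?s0 ?k10.
have rp := realD rm rk2; have rn := realB rm rk2.
rewrite discr_factor; split=> [/eqP|[q0 q1]].
  rewrite mulf_eq0 !fac // e1 e2.
  by move=> /orP[] /andP[/eqP-> /eqP->]; split=> //; [right|left].
apply/eqP; rewrite mulf_eq0 !fac // e1 e2 q0 eqxx /=.
by case: q1 => ->; rewrite eqxx ?orbT.
Qed.

Lemma off_focal_real : g2 \is Num.real ->
  off_focal g2 k1 k2 = [set q | ellS g2 k1 k2 q != 0].
Proof.
move=> rg; apply/seteqP; split=> q /=; first by case.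
by split=> //; rewrite le_gtF // discr_ge0.
Qed.

Lemma lam_real q : g2 \is Num.real ->
  [/\ lam1 g2 k1 k2 q \is Num.real, lam2 g2 k1 k2 q \is Num.real &
      ellS g2 k1 k2 q != 0 -> lam2 g2 k1 k2 q < lam1 g2 k1 k2 q].
Proof.
move=> rg; have S0 : 0 <= ellS g2 k1 k2 q by rewrite sqrtc_ge0 discr_ge0.
have rS := ger0_real S0; have [r0 r1] := (crd_real q 0, crd_real q 1).
have rT := ellT_real q rg.
have r2 : (2^-1 : R[i]) \is Num.real by rewrite realV realn.
split; [by apply: realM => //; exact: realD|by apply: realM => //; exact: realB|].
by move=> Sn; rewrite -subr_gt0 lamB lt_neqAle eq_sym Sn.
Qed.

End Discriminant.

(** * The generating function, and charts on quadrants *)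

Section Generating.
Context (R : realType) (g2 k1 k2 : R[i]).
Implicit Types (q p : 'rV[R]_2).
Local Notation J := (Jmx g2 k1 k2).

Lemma partial_F2gen j q (P : 'cV[R[i]]_2) : off_focal g2 k1 k2 q ->
  partial j (fun y => F2gen g2 k1 k2 y P) q = ((J q)^T *m P) j 0.
Proof.
move=> Uq; have d0 := is_partial_lam R g2 k1 k2 0 j q Uq.
have d1 := is_partial_lam R g2 k1 k2 1 j q Uq.
have -> : (fun y => F2gen g2 k1 k2 y P) =
    fun y => P 0 0 * lam g2 k1 k2 y 0 0 + P 1 0 * lam g2 k1 k2 y 1 0.
  by apply/funext => y; rewrite lam_0 lam_1.
have [_ ->] : is_partial j q
    (fun y => P 0 0 * lam g2 k1 k2 y 0 0 + P 1 0 * lam g2 k1 k2 y 1 0)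
    (0 * lam g2 k1 k2 q 0 0 + P 0 0 * J q 0 j +
     (0 * lam g2 k1 k2 q 1 0 + P 1 0 * J q 1 j)) by partial_tac.
by rewrite [RHS]mxE sum_ord2 !mx2T; ring.
Qed.

(** [F2gen] is linear in the momenta, so its complex difference quotient is constant off zero. *)
Lemma derive_F2gen i q (P : 'cV[R[i]]_2) :
  'D_(delta_mx i 0) (F2gen g2 k1 k2 q : _ -> R[i]^o) P = lam g2 k1 k2 q i 0.
Proof.
apply: lim_near_cst => //; near=> h.
have h0 : h != 0 by near: h; exact: nbhs_dnbhs_neq.
rewrite /F2gen /= !mxE /GRing.scale /=.
by case: (ord2P i) => -> /=; field.
Unshelve. all: by end_near. Qed.

Lemma generated_byP q p (Q P : 'cV[R[i]]_2) : off_focal g2 k1 k2 q ->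
  generated_by (F2gen g2 k1 k2) q p Q P <->
  Q = lam g2 k1 k2 q /\ colC p = (J q)^T *m P.
Proof.
move=> Uq; split=> [[ep eQ]|[-> ep]].
  split; first by apply/matrixP => i j; rewrite (ord1 j) eQ derive_F2gen.
  by apply/matrixP => i j; rewrite (ord1 j) -partial_F2gen // -ep mxE.
split=> [j|i]; last by rewrite derive_F2gen.
by rewrite partial_F2gen // -ep mxE.
Qed.

Hypotheses (k10 : k1 != 0) (k20 : k2 != 0).

Lemma J_unitP q : off_focal g2 k1 k2 q ->
  J q \in unitmx <-> [/\ g2 != 0, q 0 0 != 0 & q 0 1 != 0].
Proof.
move=> Uq; have [S0 _] := Uq; have := det_J R g2 k1 k2 q Uq.
rewrite unitmxE unitfE -!crd_eq0 => e.
have -> : (\det (J q) != 0) = (ellS g2 k1 k2 q * \det (J q) != 0).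
  by rewrite mulf_eq0 (negPf S0).
rewrite e !mulf_eq0 !orbb (negPf k10) (negPf k20) pnatr_eq0 /= !orbF !negb_or.
by split=> [/andP[/andP[-> ->] ->]|[-> -> ->]].
Qed.

(** Sum and product of the eigenvalues return T and P. P determines the square of q2, and T then
    that of q1. *)
Lemma lam_coord_sqr q q' : g2 != 0 -> lam g2 k1 k2 q = lam g2 k1 k2 q' ->
  forall j, q 0 j ^+ 2 = q' 0 j ^+ 2.
Proof.
move=> g0 ll; have l1 : lam1 g2 k1 k2 q = lam1 g2 k1 k2 q' by rewrite -!lam_0 ll.
have l2 : lam2 g2 k1 k2 q = lam2 g2 k1 k2 q' by rewrite -!lam_1 ll.
have eT := lamD R g2 k1 k2 q; have eP := lamM R g2 k1 k2 q.
rewrite l1 l2 lamD in eT; rewrite l1 l2 lamM in eP.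
have e1 : crd q 1 ^+ 2 = crd q' 1 ^+ 2.
  have c0 : g2 * k1 ^+ 2 * k2 ^+ 2 != 0 by rewrite !mulf_neq0 ?expf_neq0.
  by apply: (mulfI c0); exact/esym.
have e0 : crd q 0 ^+ 2 = crd q' 0 ^+ 2.
  apply: (mulfI g0); move: eT; rewrite /ellT e1 => /addIr.
  by rewrite !mulrDr => /addIr.
have toR i : crd q i ^+ 2 = crd q' i ^+ 2 -> q 0 i ^+ 2 = q' 0 i ^+ 2.
  by rewrite /crd -!rmorphXn /= => -[].
by move=> j; case: (ord2P j) => ->; apply: toR.
Qed.

(** Positive products with the coordinates of [q0] fix the signs that [lam] cannot see. *)
Definition quadrant q0 : set 'rV[R]_2 :=
  off_focal g2 k1 k2 `&` [set q | 0 < q 0 0 * q0 0 0] `&` [set q | 0 < q 0 1 * q0 0 1].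

Lemma open_quadrant q0 : open (quadrant q0).
Proof.
have o (i : 'I_2) : open [set q : 'rV[R]_2 | 0 < q 0 i * q0 0 i].
  rewrite (_ : [set q | _] = (fun q : 'rV[R]_2 => q 0 i * q0 0 i) @^-1` [set r | 0 < r]) //.
  apply: open_comp; last exact: open_gt.
  move=> q _; have [] := (Ck_on_coord R 2 0 setT i, Ck_on_cst R 2 0 setT (q0 0 i)).
  move=> ci cc; exact: (Ck_onM _ _ _ _ _ _ openT ci cc q I).
by apply: openI; [apply: openI; [exact: open_off_focal|exact: o]|exact: o].
Qed.

Lemma quadrant_inj q0 : g2 != 0 -> {in quadrant q0 &, injective (lam g2 k1 k2)}.
Proof.
move=> g0 q q' /set_mem[[_ a0] a1] /set_mem[[_ b0] b1] ll.
have sq := lam_coord_sqr q q' g0 ll.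
have sgn (a b c : R) : 0 < a * c -> 0 < b * c -> a ^+ 2 = b ^+ 2 -> a = b.
  move=> ac bc /eqP; rewrite eqf_sqr => /orP[/eqP //|/eqP ab].
  by move: ac; rewrite ab mulNr oppr_gt0 => /(lt_trans bc); rewrite ltxx.
apply/rowP => j; case: (ord2P j) => ->.
  by apply: sgn a0 b0 _; exact: sq.
by apply: sgn a1 b1 _; exact: sq.
Qed.

Lemma quadrant_unit q0 q : g2 != 0 -> quadrant q0 q -> J q \in unitmx.
Proof.
move=> g0 [[Fq a0] a1]; apply/J_unitP => //; split=> //.
  by apply: contraTneq a0 => ->; rewrite mul0r ltxx.
by apply: contraTneq a1 => ->; rewrite mul0r ltxx.
Qed.

End Generating.

(** Here [K] and [k] stand for k2 ^ 2 and k1 ^ 2, [x0], [x1] for the positions, [P0], [P1] for the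
    new momenta and [p0], [p1] for the old ones. The last two hypotheses are p = J^T P multiplied by
    S. *)
Lemma staeckel_identity (F : fieldType) (g1 g2 K k x0 x1 l1 l2 P0 P1 p0 p1 : F) :
  k = 1 - K -> l1 - l2 != 0 ->
  l1 + l2 = g2 * (x0 ^+ 2 + k * x1 ^+ 2) + K ->
  l1 * l2 = g2 * k * K * x1 ^+ 2 ->
  (l1 - l2) * p0 = 2 * g2 * x0 * l1 * P0 - 2 * g2 * x0 * l2 * P1 ->
  (l1 - l2) * p1 = 2 * g2 * k * x1 * (l1 - K) * P0 - 2 * g2 * k * x1 * (l2 - K) * P1 ->
  p0 ^+ 2 + p1 ^+ 2 + g1 * (x0 * p0 + x1 * p1) + g2 * (x0 * p0 + x1 * p1) ^+ 2 =
  (4 * g2 * l1 * (l1 - K) * (l1 + k) * P0 ^+ 2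
   - 4 * g2 * l2 * (l2 - K) * (l2 + k) * P1 ^+ 2
   + 2 * g1 * l1 * (l1 - K) * P0 - 2 * g1 * l2 * (l2 - K) * P1) / (l1 - l2).
Proof.
move=> hk S0 hT hP e0 e1.
(* These are the components of l dT - dP, so S p = u(l1) P0 - u(l2) P1. *)
pose u0 l := 2 * g2 * x0 * l; pose u1 l := 2 * g2 * k * x1 * (l - K).
(* The pairings of u with the position vector and with itself are polynomials in l1 and l2, which
   eliminates x. At l = l1 the first one is 2 l1 (l1 - K), the origin of [gfun]. *)
have qu l : x0 * u0 l + x1 * u1 l = 2 * l * (l1 + l2 - K) - 2 * (l1 * l2).
  by rewrite hT hP /u0 /u1; ring.
have uu l m : u0 l * u0 m + u1 l * u1 m =
    4 * g2 * ((l1 + l2 - K) * l * m - l1 * l2 * ((l - K) * (m - K) - K + l + m)).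
  by rewrite hT hP /u0 /u1 hk; ring.
apply: (mulfI (mulf_neq0 S0 S0)).
transitivity (((l1 - l2) * p0) ^+ 2 + ((l1 - l2) * p1) ^+ 2
  + g1 * (l1 - l2) * (x0 * ((l1 - l2) * p0) + x1 * ((l1 - l2) * p1))
  + g2 * (x0 * ((l1 - l2) * p0) + x1 * ((l1 - l2) * p1)) ^+ 2); first by ring.
rewrite e0 e1.
(* The Hamiltonian sorted by monomials in P0 and P1. The coefficient of P0 P1 vanishes once u is
   eliminated, since u(l1) . u(l2) = - 4 g2 l1 l2 (l1 - K) (l2 - K) cancels against the g2 term: the
   coordinates are orthogonal. *)
transitivity (
  (u0 l1 * u0 l1 + u1 l1 * u1 l1 + g2 * (x0 * u0 l1 + x1 * u1 l1) ^+ 2) * P0 ^+ 2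
  - 2 * (u0 l1 * u0 l2 + u1 l1 * u1 l2
         + g2 * (x0 * u0 l1 + x1 * u1 l1) * (x0 * u0 l2 + x1 * u1 l2)) * P0 * P1
  + (u0 l2 * u0 l2 + u1 l2 * u1 l2 + g2 * (x0 * u0 l2 + x1 * u1 l2) ^+ 2) * P1 ^+ 2
  + g1 * (l1 - l2) * ((x0 * u0 l1 + x1 * u1 l1) * P0 - (x0 * u0 l2 + x1 * u1 l2) * P1)).
  by rewrite /u0 /u1; ring.
rewrite !uu !qu hk; field.
exact: S0.
Qed.

Section Staeckel.
Context (R : realType) (g1 g2 k1 k2 : R[i]).
Hypotheses (hk : k1 ^+ 2 + k2 ^+ 2 = 1) (k10 : k1 != 0) (k20 : k2 != 0)
  (rk2 : k2 \is Num.real).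
Local Notation J := (Jmx g2 k1 k2).
Implicit Types (x : 'rV[R]_(2 + 2)) (q : 'rV[R]_2).

Lemma H2_newP x : off_focal g2 k1 k2 (pos x) -> J (pos x) \in unitmx ->
  let l1 := lam1 g2 k1 k2 (pos x) in
  let l2 := lam2 g2 k1 k2 (pos x) in
  let P := newP g2 k1 k2 (pos x) (mom x) in
  H2 g1 g2 x =
    (hfun g2 k1 k2 l1 * P 0 0 ^+ 2 - hfun g2 k1 k2 l2 * P 1 0 ^+ 2
     + gfun g1 k2 l1 * P 0 0 - gfun g1 k2 l2 * P 1 0) / (l1 - l2).
Proof.
move=> Uq uJ l1 l2 P.
have e j : crd (mom x) j = J (pos x) 0 j * P 0 0 + J (pos x) 1 j * P 1 0.
  have : (J (pos x))^T *m P = colC (mom x).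
    by rewrite mulmxA -trmx_mul mulVmx // trmx1 mul1mx.
  move=> /matrixP/(_ j 0); rewrite [LHS]mxE sum_ord2 [RHS]mxE => <-.
  by rewrite !mx2T.
have a0 j : (l1 - l2) * J (pos x) 0 j =
    l1 * dellT R g2 k1 j (pos x) - dellP R g2 k1 k2 j (pos x).
  have := J_lam R g2 k1 k2 0 j (pos x) Uq; rewrite /lamR lam_0 -lamD -/l1 -/l2 => <-.
  by ring.
have a1 j : (l1 - l2) * J (pos x) 1 j =
    - (l2 * dellT R g2 k1 j (pos x) - dellP R g2 k1 k2 j (pos x)).
  have := J_lam R g2 k1 k2 1 j (pos x) Uq; rewrite /lamR lam_1 -lamD -/l1 -/l2 => <-.
  by ring.
have ep j : (l1 - l2) * crd (mom x) j =
    (l1 - l2) * J (pos x) 0 j * P 0 0 + (l1 - l2) * J (pos x) 1 j * P 1 0.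
  by rewrite e; ring.
rewrite /H2 /hfun /gfun; apply: staeckel_identity.
- by rewrite -hk; ring.
- by rewrite /l1 /l2 lamB; case: Uq.
- by rewrite /l1 /l2 lamD.
- by rewrite /l1 /l2 lamM.
- by rewrite ep a0 a1 /dellT /dellP /=; ring.
- by rewrite ep a0 a1 /dellT /dellP /=; ring.
Qed.

(** The strict inequalities make S positive and P nonzero. They exclude g2 = 0 and q2 = 0 through P,
    and q1 = 0 through the values at k2 ^ 2. *)
Lemma off_focal_J_unit q :
  k2 ^+ 2 < lam1 g2 k1 k2 q -> lam2 g2 k1 k2 q < k2 ^+ 2 -> 0 < lam2 g2 k1 k2 q ->
  off_focal g2 k1 k2 q /\ J q \in unitmx.
Proof.
move=> h1 h2 h3; have S0 : 0 < ellS g2 k1 k2 q by rewrite -lamB subr_gt0 (lt_trans h2).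
have Uq : off_focal g2 k1 k2 q.
  split; first by rewrite gt_eqF.
  by rewrite -ellS_sqr le_gtF // exprn_ge0 // ltW.
split=> //; apply/J_unitP => //.
have P0 : ellP g2 k1 k2 q != 0.
  by rewrite -lamM mulf_neq0 // gt_eqF // (lt_trans h3) // (lt_trans h2).
split.
- by apply: contraNneq P0 => g0; rewrite /ellP g0 !mul0r.
(* This product is the characteristic polynomial of A at k2 ^ 2, which equals - g2 k2 ^ 2 q1 ^ 2. *)
- have : (lam1 g2 k1 k2 q - k2 ^+ 2) * (lam2 g2 k1 k2 q - k2 ^+ 2) != 0.
    by rewrite mulf_neq0 // subr_eq0 ?(gt_eqF h1) ?(lt_eqF h2).
  apply: contraNneq => q0; apply/eqP.
  transitivity (lam1 g2 k1 k2 q * lam2 g2 k1 k2 q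
    - k2 ^+ 2 * (lam1 g2 k1 k2 q + lam2 g2 k1 k2 q) + k2 ^+ 2 * k2 ^+ 2); first by ring.
  rewrite lamM lamD /ellP /ellT; have -> : crd q 0 = 0 by rewrite /crd q0.
  by ring.
- apply: contraNneq P0 => q1; have q10 : crd q 1 = 0 by rewrite /crd q1.
  by apply/eqP; rewrite /ellP q10; ring.
Qed.

End Staeckel.

Theorem mainTheorem6 (R : realType) (g1 g2 : R[i]) (f : R) (k1 k2 : R[i])
    (hg1 : complex.Im g1 = 0 \/ complex.Re g1 = 0)
    (hg2 : complex.Im g2 = 0 \/ complex.Re g2 = 0)
    (hf0 : 0 < f) (hf1 : f < pi / 2)
    (hk1 : k1 = (cos f)%:C) (hk2 : k2 = (sin f)%:C) :
  [/\ complex.Im g2 = 0 -> forall q : 'rV[R]_2, 0 <= discr g2 k1 k2 q,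
      0 < g2 -> forall q : 'rV[R]_2,
        discr g2 k1 k2 q =
          (g2 * crd q 0 ^+ 2 + (sqrtc g2 * k1 * crd q 1 + k2) ^+ 2) *
          (g2 * crd q 0 ^+ 2 + (sqrtc g2 * k1 * crd q 1 - k2) ^+ 2) &
      0 < g2 -> forall q : 'rV[R]_2,
        discr g2 k1 k2 q = 0 <->
        crd q 0 = 0 /\ (crd q 1 = k2 / (sqrtc g2 * k1) \/
                        crd q 1 = - (k2 / (sqrtc g2 * k1)))] /\
  ([/\ Nijenhuis_operator (N_e g2 k1 k2),
       forall (x : 'rV[R]_(2 + 2)) (a : R[i]),
         eigenvalue (N_e g2 k1 k2 x) a <->
         a = lam1 g2 k1 k2 (pos x) \/ a = lam2 g2 k1 k2 (pos x),
       forall q : 'rV[R]_2,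
         lam1 g2 k1 k2 q != lam2 g2 k1 k2 q <-> ellS g2 k1 k2 q != 0 &
       complex.Im g2 = 0 ->
         off_focal g2 k1 k2 = [set q | ellS g2 k1 k2 q != 0] /\
         forall q : 'rV[R]_2,
           [/\ lam1 g2 k1 k2 q \is Num.real, lam2 g2 k1 k2 q \is Num.real &
               ellS g2 k1 k2 q != 0 -> lam2 g2 k1 k2 q < lam1 g2 k1 k2 q]] /\
   [/\ open (off_focal g2 k1 k2),
       smooth_on (off_focal g2 k1 k2) (lam1 g2 k1 k2) /\
       smooth_on (off_focal g2 k1 k2) (lam2 g2 k1 k2),
       forall (q p : 'rV[R]_2) (Q P : 'cV[R[i]]_2), off_focal g2 k1 k2 q ->
         generated_by (F2gen g2 k1 k2) q p Q P <->
         Q = lam g2 k1 k2 q /\ colC p = (Jmx g2 k1 k2 q)^T *m P &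
       forall q : 'rV[R]_2, off_focal g2 k1 k2 q ->
         (Jmx g2 k1 k2 q \in unitmx <->
          [/\ g2 != 0, q 0 0 != 0 & q 0 1 != 0])] /\
   forall q : 'rV[R]_2, off_focal g2 k1 k2 q -> Jmx g2 k1 k2 q \in unitmx ->
     (forall (p : 'rV[R]_2) (P : 'cV[R[i]]_2),
        colC p = (Jmx g2 k1 k2 q)^T *m P <->
        P = (invmx (Jmx g2 k1 k2 q))^T *m colC p) /\
     exists2 U : set 'rV[R]_2,
       [/\ open U, U q & U `<=` off_focal g2 k1 k2] &
       Darboux_Haantjes [set x | U (pos x)]
         (K_e g2 k1 k2) (ell_map g2 k1 k2) /\
       extended_point_transformation [set x | U (pos x)]
         (ell_map g2 k1 k2)) /\
  (forall x : 'rV[R]_(2 + 2),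
     let q := pos x in
     let l1 := lam1 g2 k1 k2 q in
     let l2 := lam2 g2 k1 k2 q in
     let P := newP g2 k1 k2 q (mom x) in
     k2 ^+ 2 < l1 -> l2 < k2 ^+ 2 -> 0 < l2 ->
     [/\ off_focal g2 k1 k2 q, Jmx g2 k1 k2 q \in unitmx &
         H2 g1 g2 x =
           (hfun g2 k1 k2 l1 * P 0 0 ^+ 2 - hfun g2 k1 k2 l2 * P 1 0 ^+ 2
            + gfun g1 k2 l1 * P 0 0 - gfun g1 k2 l2 * P 1 0)
           / (l1 - l2)]) /\
  (forall q : 'rV[R]_2, off_focal g2 k1 k2 q ->
     lam1 g2 k1 k2 q - lam2 g2 k1 k2 q = ellS g2 k1 k2 q /\
     lam1 g2 k1 k2 q - lam2 g2 k1 k2 q != 0).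
Proof.
have k1R : k1 \is Num.real by rewrite hk1 complex_real.
have k2R : k2 \is Num.real by rewrite hk2 complex_real.
have k10 : k1 != 0.
  rewrite hk1 fmorph_eq0 gt_eqF // cos_gt0_pihalf // hf1 andbT.
  by rewrite (lt_trans _ hf0) // oppr_lt0 divr_gt0 // pi_gt0.
have k20 : k2 != 0.
  by rewrite hk2 fmorph_eq0 gt_eqF // sin_gt0_pihalf // hf0.
have hk : k1 ^+ 2 + k2 ^+ 2 = 1.
  by rewrite hk1 hk2 -!rmorphXn -rmorphD /= cos2Dsin2.
split.
  split.
  - by move=> /real_Im0 g2R q; exact: discr_ge0.
  - by move=> _ q; exact: discr_factor.
  - by move=> g20 q; exact: discr_eq0.
split.
  split; last split.
  - split.
    + exact: Nijenhuis_N_e.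
    + exact: eigenvalue_N_e.
    + by move=> q; rewrite -lamB subr_eq0.
    + move=> /real_Im0 g2R; split; first exact: off_focal_real.
      by move=> q; exact: lam_real.
  - split.
    + exact: open_off_focal.
    + by split; [exact: smooth_lam1|exact: smooth_lam2].
    + by move=> q p Q P; exact: generated_byP.
    + by move=> q; exact: J_unitP.
  - move=> q Fq uJ; have uJT : (Jmx g2 k1 k2 q)^T \in unitmx by rewrite unitmx_tr.
    split.
      move=> p P; rewrite trmx_inv; split=> ->; first by rewrite mulKmx.
      by rewrite mulKVmx.
    (* Invertibility at [q] already keeps [q] off both axes, so [quadrant] based at [q] contains [q]
       and can serve as the required open set. *)
    have [g20 q00 q01] := (J_unitP R g2 k1 k2 k10 k20 q Fq).1 uJ.
    have oU := open_quadrant R g2 k1 k2 q.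
    have UF : quadrant R g2 k1 k2 q `<=` off_focal g2 k1 k2 by move=> y [[]].
    have UJ y : quadrant R g2 k1 k2 q y -> Jmx g2 k1 k2 y \in unitmx.
      exact: quadrant_unit.
    exists (quadrant R g2 k1 k2 q); first split=> //.
      by split; [split=> //|]; rewrite /= -expr2 exprn_even_gt0.
    split; last exact: extended_point_transformation_ell_map.
    by apply: Darboux_Haantjes_ell_map => //; exact: quadrant_inj.
split.
  move=> x q l1 l2 P h1 h2 h3.
  have [Fq uJ] := off_focal_J_unit R g2 k1 k2 k10 k20 q h1 h2 h3.
  by split=> //; exact: H2_newP.
by move=> q [S0 _]; rewrite lamB.
Qed.
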